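(* Let $n_1,n_2\ge1$, $n=n_1n_2$, $s\ge1$, $m>0$, $\delta\in(0,1)$, let $\mathcal{C}$ be the class of $s$-submatrices of an $n_1\times n_2$ matrix (assumed nonempty), and suppose the signal magnitude $\mu>0$ satisfies $$\mu \geq \sqrt{\frac{2n}{sm} \left( \log \frac{4}{\delta} \right)^2 + \frac{2s}{m} \log \frac{8n}{\delta} + \frac{2(n_1 + n_2)}{m} \log \frac{8s}{\delta}} .$$ Then the search/refinement procedure for submatrices described in the context, with sufficiently small measurement precision $\Gamma$, results in an estimator $\hat S$ satisfying $$\max_{S\in\mathcal{C}}\mathbb{P}_S(\hat S\ne S)\le\delta ,$$ and satisfies the precision budget $\mathbb{E}_S\big(\sum_j\Gamma_j\big)\le m$ for every $S\in\mathcal{C}$.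
   Context: The $n=n_1n_2$ coordinates of the signal are identified with $\{1,\dots,n_1\}\times\{1,\dots,n_2\}$. An $s$-submatrix is a set $S_1\times S_2$ with $S_1\subseteq\{1,\dots,n_1\}$, $S_2\subseteq\{1,\dots,n_2\}$ and $|S_1|\cdot|S_2|=s$. Sensing model. For an unknown support set $S\in\mathcal{C}$ and $\mu>0$, the signal $\boldsymbol{x}\in\mathbb{R}^n$ has $x_i=\mu$ if $i\in S$ and $x_i=0$ otherwise. One collects measurements $Y_j=x_{A_j}+\Gamma_j^{-1/2}W_j$, $j=1,2,\dots$, where $A_j$ is the measured coordinate, $\Gamma_j>0$ is its precision, and the $W_j$ are i.i.d. $\mathcal{N}(0,1)$ with $W_j$ independent of $\{A_i,\Gamma_i\}_{i\le j}$. In adaptive sensing $A_j,\Gamma_j$ may depend on $\{Y_i,A_i,\Gamma_i\}_{i<j}$. Sums over $j$ run over the measurements made. The values $n,m,\mu$ and the class $\mathcal{C}$ are known; only $S$ is unknown. $\mathbb{P}_S,\mathbb{E}_S$ are probability and expectation when the support is $S$. Procedure. All measurements have the same precision $\Gamma_j=\Gamma$, taken sufficiently small. At step $t=1,2,\dots$ the procedure queries a coordinate $Q_t$ (no coordinate is queried twice) and computes a binary answer $\Psi_t$ (a surrogate for $\mathbf{1}\{Q_t\in S\}$) by a sequential likelihood ratio test with target type I and type II error probabilities $\alpha_t,\beta_t$: coordinate $Q_t$ is measured repeatedly, giving $y_1,y_2,\dots$, until the first $r$ at which $\bar z_r=\sum_{i=1}^r\log\frac{f_1(y_i)}{f_0(y_i)}$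 leaves the interval $(l_t,u_t)$, where $f_0,f_1$ are the densities of $\mathcal{N}(0,\Gamma^{-1})$ and $\mathcal{N}(\mu,\Gamma^{-1})$, $l_t=\log\frac{\beta_t}{1-\alpha_t}$ and $u_t=\log\frac{1-\beta_t}{\alpha_t}$; then $\Psi_t=1$ if $\bar z_r\ge u_t$ and $\Psi_t=0$ if $\bar z_r\le l_t$. A coordinate is treated as non-zero when its answer is $1$. Queries: in the search phase coordinates are queried at random (uniformly among those not yet queried) until a non-zero coordinate is found, with at most $J=\frac ns\log\frac2\delta$ queries; in the refinement phase the coordinates in the row and in the column of the non-zero coordinate found are queried. Error probabilities: $\alpha_t=\delta/(8n)$ for all $t$, $\beta_t=\delta/4$ in the search phase, $\beta_t=\delta/(8s)$ in the refinement phase. The procedure stops at the first step $T$ at which there is at most one $S'\in\mathcal{C}$ with $\Psi_i=\mathbf{1}\{Q_i\in S'\}$ for all $i\le T$ (or when the search phase exhausts its $J$ queries without finding a non-zero coordinate). The estimator $\hat S$ is the unique $S'\in\mathcal{C}$ agreeing with all answers if there is exactly one, and $\hat S=\emptyset$ otherwise.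
   Formalization: The search phase is allowed J rounded up to an integer number of queries; with at most J queries read literally the claim fails when J<1 (e.g. n_1=4, n_2=1, s=3, δ=0.946: no query is made and the error probability is 1). *)

(* Defs.v *)
From HB Require Import structures.
From mathcomp Require Import all_boot all_order all_algebra.
From mathcomp Require Import all_classical all_reals all_analysis.

Set Implicit Arguments.
Unset Strict Implicit.
Unset Printing Implicit Defensive.

Import Order.TTheory GRing.Theory Num.Theory.
Local Open Scope ring_scope.

Definition cell (n1 n2 : nat) : finType := ('I_n1 * 'I_n2)%type.

Definition submatrices (n1 n2 s : nat) : {set {set cell n1 n2}} :=
  [set S : {set cell n1 n2} | [exists S1 : {set 'I_n1}, exists S2 : {set 'I_n2},
    (S == finset.setX S1 S2) && (#|S1| * #|S2| == s)%N]]%SET.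

Definition signal (R : realType) n1 n2 (mu : R) (S : {set cell n1 n2})
  (q : cell n1 n2) : R := if q \in S then mu else 0.

Definition cross n1 n2 (c : cell n1 n2) : {set cell n1 n2} :=
  [set q : cell n1 n2 | (q.1 == c.1) || (q.2 == c.2)]%SET.

(* A selector [f] maps each set of coordinates to the element drawn from it;
   the values at the empty set are irrelevant. *)
Definition selector (n1 n2 : nat) : finType :=
  {ffun {set cell n1 n2} -> cell n1 n2}.

(* [answers] lists the pairs (Q_i, Psi_i), i <= t, in the order of the queries;
   [test] is the coordinate under test with the current log-likelihood ratio,
   or [None] between two tests. *)
Record state (R : realType) (n1 n2 : nat) := State {
  answers : seq (cell n1 n2 * bool) ;
  test : option (cell n1 n2 * R) }.

Section Procedure.
Variables (R : realType) (n1 n2 s : nat) (delta mu Gamma : R).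
(* [order c]: the order in which the row and the column of [c] are queried *)
Variable order : cell n1 n2 -> seq (cell n1 n2).

Local Notation cell := (cell n1 n2).
Local Notation n := (n1 * n2)%N.
Implicit Types (qa : seq (cell * bool)) (q : cell).

Definition unqueried qa : {set cell} :=
  [set q | q \notin [seq a.1 | a <- qa]]%SET.

Definition consistent qa : {set {set cell}} :=
  [set S in submatrices n1 n2 s | all (fun a => a.2 == (a.1 \in S)) qa]%SET.

(* The first coordinate with answer 1; the search phase lasts as long as
   there is none. *)
Definition found qa : option cell := ohead [seq a.1 | a <- qa & a.2].

Definition max_search : R := n%:R / s%:R * ln (2 / delta).

(* As [max_search] need not be an integer, the search phase is exhausted once
   the number of queries reaches it, i.e., after [ceil max_search] queries. *)
Definition exhausted qa : bool :=
  (found qa == None) && (max_search <= (size qa)%:R).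

(* The steps are t = 1, 2, ..., so that at least one query is made. *)
Definition stopped qa : bool :=
  (0 < size qa)%N && ((#|consistent qa| <= 1)%N || exhausted qa).

Definition next_query (f : selector n1 n2) qa : option cell :=
  if stopped qa then None else
  if found qa is Some c then ohead [seq q <- order c | q \in unqueried qa]
  else Some (f (unqueried qa)).

Definition alpha : R := delta / (8 * n%:R).

Definition beta qa : R :=
  if found qa is Some _ then delta / (8 * s%:R) else delta / 4.

Definition lower qa : R := ln (beta qa / (1 - alpha)).
Definition upper qa : R := ln ((1 - beta qa) / alpha).

Definition noise_sd : R := (Num.sqrt Gamma)^-1.

Definition llr (y : R) : R :=
  ln (normal_pdf mu noise_sd y / normal_pdf 0 noise_sd y).

Definition target (f : selector n1 n2) (st : state R n1 n2) : option cell :=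
  if test st is Some (q, _) then Some q else next_query f (answers st).

Definition update (st : state R n1 n2) q (y : R) : state R n1 n2 :=
  let qa := answers st in
  let z := (if test st is Some (_, z0) then z0 else 0) + llr y in
  if upper qa <= z then State (rcons qa (q, true)) None
  else if z <= lower qa then State (rcons qa (q, false)) None
  else State qa (Some (q, z)).

Section Run.
Variables (S : {set cell}) (U : nat -> selector n1 n2) (W : nat -> R).

(* The state before measurement [j] (counted from 0).  The unknown support [S]
   enters only through the value of that measurement, whose noise is [W j];
   if it starts a test of the search phase, its coordinate is drawn by [U j]. *)
Fixpoint run (j : nat) : state R n1 n2 :=
  if j is i.+1 then
    if target (U i) (run i) is Some q
    then update (run i) q (signal mu S q + noise_sd * W i)
    else run i
  else State [::] None.

(* Gamma_j, or 0 if the procedure stops before measurement [j]. *)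
Definition precision (j : nat) : R :=
  if target (U j) (run j) is Some _ then Gamma else 0.

Definition total_precision : \bar R :=
  (\sum_(0 <= j <oo) (precision j)%:E)%E.

Definition estimate qa : {set cell} :=
  odflt finset.set0 [pick A | consistent qa == [set A]%SET].

(* If some test never ends, then no step is the last one and the estimator is
   taken to be empty. *)
Definition estimator : {set cell} :=
  xget finset.set0 [set A | exists j,
    stopped (answers (run j)) /\ A = estimate (answers (run j))]%classic.

End Run.
End Procedure.

Definition mutually_independent d (T : measurableType d) (R : realType)
    (P : probability T R) (I : eqType) (F : I -> set (set T)) : Prop :=
  forall (J : seq I) (E : I -> set T), uniq J -> (forall i, i \in J -> F i (E i)) ->
  (P (\big[setI/setT]_(i <- J) E i) = \prod_(i <- J) P (E i))%E.

Section SensingModel.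
Context d (T : measurableType d) (R : realType) (P : probability T R).
Variables (n1 n2 : nat) (U : nat -> T -> selector n1 n2) (W : nat -> {RV P >-> R}).

Definition events (i : nat + nat) : set (set T) :=
  match i with
  | inl j => preimage_set_system setT (U j) setT
  | inr j => preimage_set_system setT (W j) measurable
  end.

(* The noise is i.i.d. standard normal, [U j] draws uniformly from each
   nonempty set of coordinates, and all these variables are independent. *)
Definition sensing_model : Prop :=
  [/\ forall j (B : set (selector n1 n2)), measurable (U j @^-1` B)%classic,
      forall j (A : {set cell n1 n2}) (a : cell n1 n2), a \in A ->
        P [set w | U j w A = a]%classic = (#|A|%:R^-1)%:E,
      forall j, distribution P (W j) = normal_prob 0 1 :> (set R -> \bar R)
    & mutually_independent P events].

End SensingModel.

(* Main.v *)
(* The state of the procedure is a Markov chain, and both claims follow from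
   supermartingales along it.

   Precision.  In a test of a coordinate of the support the log-likelihood ratio
   has drift Gamma mu^2 / 2 towards the upper boundary, and otherwise the opposite
   drift, so a test spends about 2 / mu^2 times the distance |l_t| or u_t to the
   boundary.  The factors 1 - alpha_t and 1 - beta_t in l_t and u_t leave room for
   the overshoot when Gamma is small.  At most s tests concern the support, at most
   n_1 + n_2 tests take place in the refinement phase, and the expected number of
   null coordinates tested in the search phase is at most J + 1 - s / n, where
   1 - s / n <= (n / s) ln 2 turns ln (2 / delta) into ln (4 / delta).

   Error.  By Wald's argument a test errs with probability at most
   alpha_t / (1 - beta_t) or beta_t / (1 - alpha_t), whatever the overshoot.  The
   search misses the support with probability p <= delta / 2, and a type II error
   matters only if it does not; this factor 1 - p compensates for the denominators.

   The precision bound also shows that the procedure almost surely stops. *)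

Require Import Defs.
From HB Require Import structures.
From mathcomp Require Import all_boot all_order all_algebra.
From mathcomp Require Import all_classical all_reals all_analysis measurable_realfun.
From mathcomp Require Import ring lra.
Set Implicit Arguments.
Unset Strict Implicit.
Unset Printing Implicit Defensive.

Import Order.TTheory GRing.Theory Num.Theory.
Import numFieldNormedType.Exports.
Local Open Scope classical_set_scope.
Local Open Scope ring_scope.

(** * Independence *)

(** Both claims are instances of one Foster-Lyapunov inequality for potentials with values in
    [0, +oo]. A measurement is split into aiming and observing, so that each half uses one fresh
    variable independent of the past; product measures and Tonelli then replace conditional
    expectations. The overshoot is never analysed: the distance to the correct boundary is enlarged
    by [eps] and truncated at 0. With theta = sqrt(Gamma) mu, one measurement decreases this
    distance by theta^2 / 2 on average, while the truncation costs only O(theta^3); hence the small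
    Gamma. Half of the room - ln (1 - alpha) pays for [eps], the other half for the O(theta^3). The
    error budget is tight to first order: delta / 2 for a search that misses the support, delta / 4
    for the test that should end it, delta / 8 for the type II errors of the refinement and delta /
    8 for all false alarms add up to delta. A plain union bound would therefore exceed delta because
    of Wald's denominators. *)

Section Independence.
Context d (T : measurableType d) (R : realType) (P : probability T R).
Variables (I : eqType) (F : I -> set (set T)).
Hypothesis F_meas : forall i, F i `<=` measurable.
Hypothesis F_setT : forall i, F i setT.
Hypothesis F_setI : forall i, setI_closed (F i).

(** A pi-system that generates the sigma-algebra of the variables with index in [J]. *)
Definition cylinders (J : seq I) : set (set T) :=
  [set A | exists2 E : I -> set T, (forall i, i \in J -> F i (E i)) &
    A = \big[setI/setT]_(i <- J) E i].

Lemma cylinders_sub_measurable (J : seq I) : cylinders J `<=` measurable.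
Proof.
move=> A [E FE ->]; rewrite big_seq_cond.
by apply: bigsetI_measurable => i /andP[/FE/F_meas].
Qed.

Lemma cylinder1 (J : seq I) (j : I) (A : set T) :
  j \in J -> F j A -> cylinders J A.
Proof.
move=> jJ FA; exists (fun i => if i == j then A else setT) => [i _|].
  by case: eqP => [->|].
rewrite eqEsubset; split=> w; last by rewrite (big_rem j)//= eqxx => -[].
move=> Aw; elim/big_rec: _ => // i B _ Bw; split=> //.
by case: eqP.
Qed.

(** As functions of [A], both sides are finite measures: [P] restricted to [B], and [P B] times [P].
    Mutual independence over [k :: J] makes them agree on the pi-system of cylinders, hence on the
    sigma-algebra it generates. *)
Lemma independent_g_sigma (J : seq I) (k : I) (A B : set T) :
  mutually_independent P F -> uniq J -> k \notin J -> F k B ->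
  <<s cylinders J >> A -> P (A `&` B) = (P A * P B)%E.
Proof.
move=> indep uJ kJ FB sA.
have mB := F_meas FB.
have r0 : 0 <= fine (P B) by rewrite fine_ge0.
have PBE : P B = (fine (P B))%:E by rewrite fineK// fin_num_measure.
have mscaleE X : mscale (NngNum r0) P X = (P B * P X)%E.
  by rewrite [in RHS]PBE.
have -> : P (A `&` B) = mrestr P mB A by [].
rewrite (@g_sigma_algebra_measure_unique _ _ _ (cylinders J)
  (@cylinders_sub_measurable J) (fun _ => setT) _ _
  (mrestr P mB) (mscale (NngNum r0) P)) //.
- by rewrite muleC; exact: mscaleE.
- move=> _; exists (fun _ => setT) => [i _|]; first exact: F_setT.
  by rewrite big1.
- by rewrite bigcup_const//; exists 0%N.
- move=> _ _ [E1 FE1 ->] [E2 FE2 ->]; exists (fun i => E1 i `&` E2 i).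
    by move=> i iJ; apply: F_setI; [exact: FE1|exact: FE2].
  by rewrite big_split.
- move=> A0 [E FE ->].
  apply: etrans (esym (mscaleE _)); rewrite /mrestr.
  (* Puts [B] at index [k]; the events with index in [J] are unchanged because [k] is not in [J]. *)
  pose E' i := if i == k then B else E i.
  have E'E i : i \in J -> E' i = E i.
    by rewrite /E'; case: eqP => // -> kinJ; rewrite kinJ in kJ.
  have FE' i : i \in k :: J -> F i (E' i).
    rewrite inE /E'; case: eqP => [-> _|_ /=]; first exact: FB.
    exact: FE.
  have ukJ : uniq (k :: J) by rewrite /= kJ.
  have FEJ i : i \in J -> F i (E' i) by move=> iJ; rewrite E'E//; exact: FE.
  have bigE : \big[setI/setT]_(i <- J) E' i = \big[setI/setT]_(i <- J) E i.
    by rewrite big_seq (eq_bigr E) -?big_seq.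
  have E'k : E' k = B by rewrite /E' eqxx.
  have := indep (k :: J) E' ukJ FE'.
  by rewrite !big_cons -(indep J E' uJ FEJ) E'k bigE setIC.
- by move=> _; rewrite /= /mrestr setTI ltey_eq fin_num_measure.
Qed.

End Independence.

(** Stands in for conditioning on [X]: by independence the joint law is the product of the
    marginals, and Tonelli integrates [Y] out first. *)
Lemma integral_independent_le d d1 d2 (T : measurableType d)
    (T1 : measurableType d1) (T2 : measurableType d2) (R : realType)
    (P : probability T R) (X : {RV P >-> T1}) (Y : {RV P >-> T2})
    (f : T1 * T2 -> \bar R) (g : T1 -> \bar R) :
  (forall A B, measurable A -> measurable B ->
    P (X @^-1` A `&` Y @^-1` B) = (P (X @^-1` A) * P (Y @^-1` B))%E) ->
  measurable_fun [set: T1 * T2] f -> (forall z, 0 <= f z)%E ->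
  measurable_fun setT g ->
  (forall x, \int[distribution P Y]_y f (x, y) <= g x)%E ->
  (\int[P]_w f (X w, Y w) <= \int[P]_w g (X w))%E.
Proof.
move=> XY mf f0 mg fg.
have mXY : measurable_fun setT (fun w => (X w, Y w)).
  exact: measurable_fun_pair.
pose XYm := isMeasurableFun.Build _ _ _ _ _ mXY.
pose Z : {RV P >-> (T1 * T2)%type} := HB.pack (fun w => (X w, Y w)) XYm.
have -> : (\int[P]_w f (X w, Y w) = \int[distribution P Z]_z f z)%E.
  by rewrite ge0_integral_distribution.
have -> : (\int[distribution P Z]_z f z =
    \int[(distribution P X \x distribution P Y)%E]_z f z)%E.
  apply/esym/eq_measure_integral => A mA _.
  exact/product_measure_unique.
rewrite fubini_tonelli1//.
have g0 x : (0 <= g x)%E by apply: le_trans (fg x); exact: integral_ge0.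
rewrite -[leRHS](@ge0_integral_distribution _ _ _ _ _ _ X g)//.
apply: ge0_le_integral => //.
- by move=> x _; exact: integral_ge0.
- exact: measurable_fun_fubini_tonelli_F.
- by move=> x _; exact: fg.
Qed.

(** * The state space *)

(** Glues countably many measurable pieces along the discrete-valued [c]. With the shape of a state
    as [c], only the dependence on one real remains to be checked. *)
Lemma measurable_fun_countable_cases (D : countType) d1 d2
    (T1 : measurableType d1) (T2 : measurableType d2)
    (c : T1 -> D) (f : T1 -> T2) (g : D -> T1 -> T2) :
  (forall i, measurable (c @^-1` [set i])) ->
  (forall i, measurable_fun setT (g i)) -> (forall t, f t = g (c t) t) ->
  measurable_fun setT f.
Proof.
move=> mc mg fE _ B mB; rewrite setTI.
have -> : f @^-1` B = \bigcup_i (c @^-1` [set i] `&` g i @^-1` B).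
  rewrite eqEsubset; split=> t; first by rewrite /= fE => Bt; exists (c t).
  by move=> [i _ [/= <-]]; rewrite fE.
apply: countable_bigcupT_measurable => [|i]; first exact: countableP.
apply: measurableI; first exact: mc.
by rewrite -[X in measurable X]setTI; exact: mg.
Qed.

(** The two densities have the same variance, so the peaks and the terms quadratic in [y] cancel. *)
Lemma llrE (R : realType) (mu Gamma y : R) : 0 < Gamma ->
  llr mu Gamma y = Gamma * mu * y - Gamma * mu ^+ 2 / 2.
Proof.
move=> G0.
have sd0 : noise_sd Gamma != 0 by rewrite invr_neq0// gt_eqF// sqrtr_gt0.
have sdE : noise_sd Gamma ^+ 2 = Gamma^-1 by rewrite exprVn sqr_sqrtr// ltW.
have [p0 f0] : normal_peak (noise_sd Gamma) != 0 /\
    normal_fun 0 (noise_sd Gamma) y != 0.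
  by split; rewrite gt_eqF ?normal_peak_gt0 ?expR_gt0.
rewrite /llr !normal_pdfE// -mulf_div divff// mul1r /normal_fun -expRB expRK sdE.
by field; rewrite gt_eqF.
Qed.

Section StateSpace.
Variables (R : realType) (n1 n2 : nat).
Local Notation state := (state R n1 n2).
Local Notation cell := (cell n1 n2).
Local Notation shapes := (seq (cell * bool) * option cell)%type.

HB.instance Definition _ := gen_eqMixin state.
HB.instance Definition _ := gen_choiceMixin state.
HB.instance Definition _ := isPointed.Build state (State [::] None).

(* A state consists of a shape, of which there are countably many, and of a
   real number when a test is in progress. *)
Definition state_measurable (A : set state) : Prop :=
  forall qa q, measurable [set z : R | A (State qa (Some (q, z)))].

Let state_measurable0 : state_measurable set0.
Proof. by move=> qa q; exact: measurable0. Qed.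

Let state_measurableC (A : set state) :
  state_measurable A -> state_measurable (~` A).
Proof. by move=> mA qa q; exact: (measurableC (mA qa q)). Qed.

Let state_measurable_bigcup (A : (set state)^nat) :
  (forall i, state_measurable (A i)) -> state_measurable (\bigcup_i A i).
Proof.
move=> mA qa q.
have -> : [set z : R | (\bigcup_i A i) (State qa (Some (q, z)))] =
    \bigcup_i [set z : R | A i (State qa (Some (q, z)))] by [].
by apply: bigcupT_measurable => i; exact: mA.
Qed.

HB.instance Definition _ := @isMeasurable.Build default_measure_display state
  state_measurable state_measurable0 state_measurableC state_measurable_bigcup.

Definition state_shape (st : state) : shapes := (answers st, omap fst (test st)).

Definition state_value (st : state) : R :=
  if test st is Some (_, z) then z else 0.

(** Inverse of the pair [state_shape], [state_value]; between two tests the real is a dummy. *)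
Definition state_of (c : shapes) (z : R) : state :=
  State c.1 (omap (fun q => (q, z)) c.2).

Lemma state_ofK (st : state) : state_of (state_shape st) (state_value st) = st.
Proof. by case: st => qa [[q z]|]. Qed.

Lemma measurable_state_of (c : shapes) : measurable_fun setT (state_of c).
Proof.
move=> _ A mA; rewrite setTI; case: c => qa [q|]; first exact: mA.
rewrite (_ : _ @^-1` _ = if `[< A (State qa None) >] then setT else set0).
  by case: ifP.
by case: asboolP => H; rewrite eqEsubset; split.
Qed.

Lemma measurable_state_shape (c : shapes) : measurable (state_shape @^-1` [set c]).
Proof.
move=> qa q.
rewrite (_ : [set z : R | _] = if (qa, Some q) == c then setT else set0).
  by case: ifP.
rewrite eqEsubset; split=> z; first by move=> /= <-; rewrite eqxx.
by case: eqP.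
Qed.

Lemma measurable_state_value : measurable_fun setT state_value.
Proof.
move=> _ A mA; rewrite setTI.
have mB : state_measurable (state_value @^-1` A) by move=> qa q; exact: mA.
exact: mB.
Qed.

Lemma measurable_answers (p : pred (seq (cell * bool))) :
  measurable [set st : state | p (answers st)].
Proof.
move=> qa q; rewrite (_ : [set z : R | _] = if p qa then setT else set0).
  by case: ifP.
by rewrite eqEsubset; case: ifP => h; split=> z //=; rewrite h.
Qed.

Lemma measurable_testing (c : R) :
  measurable_fun setT (fun st : state => (if test st then c else 0)%:E).
Proof.
pose g (a : shapes) (_ : state) : \bar R := (if a.2 then c else 0)%:E.
refine (@measurable_fun_countable_cases _ _ _ state _ state_shape _ g _ _ _).
- exact: measurable_state_shape.
- by move=> a; exact: measurable_cst.
- by move=> [qa [[q z]|]].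
Qed.

Variables (s : nat) (delta mu Gamma : R) (order : cell -> seq cell).
Variable S : {set cell}.

(* Splits a step of [run] in two: [aim] only uses the random selector, [observe]
   only the noise. *)
Definition aim (f : selector n1 n2) (st : state) : state :=
  if test st is None then
    if target s delta order f st is Some q
    then State (answers st) (Some (q, 0)) else st
  else st.

Definition observe (st : state) (w : R) : state :=
  if test st is Some (q, _)
  then update s delta mu Gamma st q (signal mu S q + noise_sd Gamma * w)
  else st.

(** The two descriptions agree because [update] reads a missing test as log-likelihood ratio 0,
    which is the value [aim] records. *)
Lemma runS U W i :
  run s delta mu Gamma order S U W i.+1 =
  observe (aim (U i) (run s delta mu Gamma order S U W i)) (W i).
Proof.
rewrite [LHS]/=; set st := run _ _ _ _ _ _ _ _ _.
by case: st => qa [[q z]|] //; rewrite /observe /aim /=; case: target.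
Qed.

Hypothesis Gamma_gt0 : 0 < Gamma.

Lemma measurable_llr : measurable_fun setT (llr mu Gamma).
Proof.
rewrite (_ : llr mu Gamma = fun y => Gamma * mu * y - Gamma * mu ^+ 2 / 2).
  by apply: measurable_funB => //; exact: measurable_funM.
by apply/funext => y; exact: llrE.
Qed.

Lemma measurable_observe :
  measurable_fun setT (fun x : state * R => observe x.1 x.2).
Proof.
pose g (c : shapes) (x : state * R) :=
  observe (state_of c (state_value x.1)) x.2.
apply: (@measurable_fun_countable_cases _ _ _ _ _ (fun x => state_shape x.1) _ g).
- move=> c; rewrite -[X in measurable X]setTI.
  exact: (@measurable_fst _ _ state R measurableT _ (measurable_state_shape c)).
- move=> [qa [q|]]; last exact: (@measurable_cst _ _ _ _ _ (State qa None)).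
  rewrite /g /observe /update /=.
  have mz : measurable_fun [set: state * R] (fun x => state_value x.1 +
     llr mu Gamma (signal mu S q + noise_sd Gamma * x.2)).
    apply: measurable_funD.
      exact: (measurableT_comp measurable_state_value measurable_fst).
    apply: (measurableT_comp measurable_llr).
    by apply: measurable_funD => //; apply: measurable_funM.
  apply: measurable_fun_ifT; first exact: measurable_fun_ler.
    exact: measurable_cst.
  apply: measurable_fun_ifT; first exact: measurable_fun_ler.
    exact: measurable_cst.
  exact: (measurableT_comp (measurable_state_of (qa, Some q)) mz).
- by move=> x; rewrite /g state_ofK.
Qed.

Section Trajectory.
Context d (T : measurableType d).
Variables (U : nat -> T -> selector n1 n2) (W : nat -> T -> R).
Local Notation traj i w := (run s delta mu Gamma order S (U ^~ w) (W ^~ w) i).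

Lemma measurable_aim (i : nat) (X : T -> state) :
  (forall f, measurable (U i @^-1` [set f])) -> measurable_fun setT X ->
  measurable_fun setT (fun w => aim (U i w) (X w)).
Proof.
move=> mU mX.
pose g (c : shapes * selector n1 n2) (w : T) :=
  aim c.2 (state_of c.1 (state_value (X w))).
apply: (@measurable_fun_countable_cases _ _ _ _ _
  (fun w => (state_shape (X w), U i w)) _ g).
- move=> [c f]; rewrite (_ : _ @^-1` _ =
    X @^-1` (state_shape @^-1` [set c]) `&` U i @^-1` [set f]).
    apply: measurableI => //; rewrite -[X in measurable X]setTI.
    exact: mX (measurable_state_shape c).
  by rewrite eqEsubset; split=> w /= [-> ->].
- move=> [[qa [q|]] f]; last first.
    exact: (@measurable_cst _ _ _ _ _ (aim f (State qa None))).
  apply: (measurableT_comp (measurable_state_of (qa, Some q))).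
  exact: (measurableT_comp measurable_state_value mX).
- by move=> w; rewrite /g state_ofK.
Qed.

(** Only the variables with index below [i] are assumed measurable, and the sigma-algebra on [T] is
    arbitrary. Applied to the sigma-algebra of the past, this says that the trajectory is
    adapted. *)
Lemma measurable_run (i : nat) :
  (forall j f, (j < i)%N -> measurable (U j @^-1` [set f])) ->
  (forall j, (j < i)%N -> measurable_fun setT (W j)) ->
  measurable_fun setT (fun w => traj i w).
Proof.
elim: i => [_ _|i IH mU mW]; first exact: measurable_cst.
rewrite (_ : (fun w => traj i.+1 w) =
    (fun x => observe x.1 x.2) \o (fun w => (aim (U i w) (traj i w), W i w))).
  apply: (measurableT_comp measurable_observe).
  apply: measurable_fun_pair; last exact: mW.
  apply: measurable_aim; first by move=> f; exact: mU.
  by apply: IH => [j f ji|j ji]; [apply: mU|apply: mW]; exact: ltnW.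
by apply/funext => w; rewrite /comp -runS.
Qed.

End Trajectory.
End StateSpace.

(** * Normal integrals and the drift inequality *)

Lemma integral_probability_cst d (T : measurableType d) (R : realType)
    (P : probability T R) (c : \bar R) : (\int[P]_(_ in setT) c = c)%E.
Proof.
rewrite integral_cst// [X in (_ * X)%E](_ : _ = 1%E) ?mule1//.
exact: probability_setT.
Qed.

(* [normal_prob] is a measure on [measurableTypeR R], whose measurable sets are
   those of [R], but which is a different structure. *)
Lemma integral_distribution_normal d (T : measurableType d) (R : realType)
    (P : probability T R) (W : {RV P >-> R}) (m sigma : R) (f : R -> \bar R) :
  distribution P W = normal_prob m sigma :> (set R -> \bar R) ->
  measurable_fun setT f -> (forall x, 0 <= f x)%E ->
  (\int[distribution P W]_x f x = \int[normal_prob m sigma]_x f x)%E.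
Proof.
move=> WE mf f0.
have mid : measurable_fun setT (id : measurableTypeR R -> R).
  by move=> _ A mA; rewrite setTI.
transitivity (\int[pushforward (normal_prob m sigma)
                     (id : measurableTypeR R -> R)]_x f x)%E.
  apply: eq_measure_integral => A mA _; exact: (congr1 (@^~ A) WE).
by rewrite ge0_integral_pushforward.
Qed.

(** The Radon-Nikodym derivative and the normal density have the same integral over every measurable
    set, so they agree almost everywhere. *)
Lemma integral_normal_prob (R : realType) (m sigma : R) (f : R -> \bar R) :
  measurable_fun setT f -> (forall x, 0 <= f x)%E ->
  (\int[normal_prob m sigma]_x f x =
   \int[lebesgue_measure]_x (f x * (normal_pdf m sigma x)%:E))%E.
Proof.
move=> mf f0.
have dom := normal_prob_dominates m sigma.
rewrite -(Radon_Nikodym_SigmaFinite.change_of_variables dom f0 measurableT)//.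
apply: ae_eq_integral => //.
- apply: emeasurable_funM => //.
  exact: measurable_int (Radon_Nikodym_SigmaFinite.f_integrable dom).
- apply: emeasurable_funM => //.
  exact: measurable_int (integrable_normal_pdf m sigma).
- apply: ae_eqe_mul2l => /=; apply: integral_ae_eq => //.
  + exact: Radon_Nikodym_SigmaFinite.f_integrable.
  + exact: measurable_int (integrable_normal_pdf m sigma).
  + by move=> E _ mE; rewrite -Radon_Nikodym_SigmaFinite.f_integral.
Qed.

(** Completing the square: tilting the standard density by e^(t x) gives e^(t^2 / 2) times the
    normal density of mean [t]. *)
Lemma integral_expR_normal (R : realType) (t : R) :
  (\int[normal_prob 0 1]_x (expR (t * x))%:E = (expR (t ^+ 2 / 2))%:E)%E.
Proof.
have mt : measurable_fun setT (fun x : R => (expR (t * x))%:E).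
  apply/measurable_EFinP/(measurableT_comp (@measurable_expR R)).
  by apply: measurable_funM => //.
rewrite integral_normal_prob//.
have pdfE x : expR (t * x) * normal_pdf 0 1 x =
    expR (t ^+ 2 / 2) * normal_pdf t 1 x.
  rewrite !normal_pdfE ?oner_eq0//= /normal_fun.
  rewrite mulrCA [RHS]mulrCA -!expRD.
  by congr (_ * expR _); field.
under eq_integral do rewrite -EFinM pdfE EFinM.
rewrite integralZl//; last exact: integrable_normal_pdf.
by rewrite integral_normal_pdf mule1.
Qed.

(** * The Markov chain of states and its drift inequality *)

Section Chain.
Context d (T : measurableType d) (R : realType) (P : probability T R).
Variables (n1 n2 : nat) (U : nat -> T -> selector n1 n2) (W : nat -> {RV P >-> R}).
Hypothesis UW : sensing_model U W.
Variables (s : nat) (delta mu Gamma : R) (order : cell n1 n2 -> seq (cell n1 n2)).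
Hypothesis Gamma_gt0 : 0 < Gamma.
Variable S : {set cell n1 n2}.

Local Notation state := (state R n1 n2).
Local Notation traj i w := (run s delta mu Gamma order S (U ^~ w) (W ^~ w) i).
Local Notation aimed i w := (aim s delta order (U i w) (traj i w)).
Local Notation obs := (observe s delta mu Gamma S).

Let measurable_U i f : measurable (U i @^-1` [set f]).
Proof. by case: UW => mU _ _ _; exact: mU. Qed.

Let events_meas i : events U W i `<=` measurable.
Proof.
case: i => j _ [B mB <-]; rewrite setTI; first by case: UW => mU _ _ _; exact: mU.
by rewrite -[X in measurable X]setTI; exact: (@measurable_funPT _ _ _ _ (W j)).
Qed.

Let events_setT i : events U W i setT.
Proof. by case: i => j; exists setT; rewrite ?setTI// preimage_setT. Qed.

Let events_setI i : setI_closed (events U W i).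
Proof.
case: i => j _ _ [A mA <-] [B mB <-]; exists (A `&` B) => //.
- by rewrite preimage_setI setIACA setIid.
- exact: measurableI.
- by rewrite preimage_setI setIACA setIid.
Qed.

Let past (i : nat) : seq (nat + nat) :=
  [seq inl j | j <- iota 0 i] ++ [seq inr j | j <- iota 0 i].

Let uniq_past i : uniq (past i).
Proof.
rewrite cat_uniq !map_inj_uniq ?iota_uniq//=; last 2 first.
- by move=> ? ? [].
- by move=> ? ? [].
by rewrite andbT; apply/hasPn => _ /mapP[j _ ->]; apply/mapP => -[].
Qed.

Let inl_past i j : (inl j \in past i) = (j < i)%N.
Proof.
rewrite mem_cat mem_map; last by move=> ? ? [].
rewrite mem_iota/= add0n orbC.
by case: mapP => // -[].
Qed.

Let inr_past i j : (inr j \in past i) = (j < i)%N.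
Proof.
rewrite mem_cat [X in _ || X]mem_map; last by move=> ? ? [].
rewrite mem_iota/= add0n.
by case: mapP => // -[].
Qed.

Section PastMeasurable.
Variables (J : seq (nat + nat)) (i : nat).
Hypothesis pastJ : {subset past i <= J}.

(** Adaptedness, by equipping the sample space with the sigma-algebra of the variables in [J]. The
    list [J] may exceed [past i] because [inl i] is added to it once [U i] has been drawn. *)
Let past_traj :
  @measurable_fun _ _ (g_sigma_algebraType (cylinders (events U W) J)) state
    setT (fun w => traj i w).
Proof.
apply: (@measurable_run _ _ _ s delta mu Gamma order S Gamma_gt0 _
  (g_sigma_algebraType (cylinders (events U W) J)) U W).
- move=> j f ji; apply: sub_sigma_algebra; apply: (@cylinder1 _ _ _ _ _ _ (inl j)).
  + by move=> k; exact: events_setT.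
  + by apply: pastJ; rewrite inl_past.
  + by exists [set f] => //; rewrite setTI.
- move=> j ji _ B mB; apply: sub_sigma_algebra.
  apply: (@cylinder1 _ _ _ _ _ _ (inr j)).
  + by move=> k; exact: events_setT.
  + by apply: pastJ; rewrite inr_past.
  + by exists B.
Qed.

Lemma g_sigma_traj (A : set state) : measurable A ->
  <<s cylinders (events U W) J >> [set w | A (traj i w)].
Proof.
by move=> mA; have := past_traj measurableT mA; rewrite setTI.
Qed.

Lemma g_sigma_aimed (A : set state) : inl i \in J -> measurable A ->
  <<s cylinders (events U W) J >> [set w | A (aimed i w)].
Proof.
move=> iJ mA.
have mU f : <<s cylinders (events U W) J >> (U i @^-1` [set f]).
  apply: sub_sigma_algebra; apply: (@cylinder1 _ _ _ _ _ _ (inl i)) => //.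
  by exists [set f] => //; rewrite setTI.
have := @measurable_aim _ _ _ s delta order _
  (g_sigma_algebraType (cylinders (events U W) J)) U i _ mU past_traj
  measurableT _ mA.
by rewrite setTI.
Qed.

End PastMeasurable.

Lemma independent_traj i (A : set state) (B : set (selector n1 n2)) :
  measurable A ->
  P ([set w | A (traj i w)] `&` U i @^-1` B) =
  (P [set w | A (traj i w)] * P (U i @^-1` B))%E.
Proof.
move=> mA; case: UW => _ _ _ ind.
apply: (independent_g_sigma events_meas events_setT events_setI ind
  (uniq_past i) (k := inl i)).
- by rewrite inl_past ltnn.
- by exists B => //; rewrite setTI.
- exact: g_sigma_traj.
Qed.

(** The aimed state has already used [U i], so [inl i] joins the past, while [inr i] is still
    fresh. *)
Lemma independent_aimed i (A : set state) (B : set R) :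
  measurable A -> measurable B ->
  P ([set w | A (aimed i w)] `&` W i @^-1` B) =
  (P [set w | A (aimed i w)] * P (W i @^-1` B))%E.
Proof.
move=> mA mB; case: UW => _ _ _ ind.
apply: (independent_g_sigma events_meas events_setT events_setI ind
  (J := inl i :: past i) (k := inr i)).
- by rewrite /= inl_past ltnn uniq_past.
- by rewrite inE/= inr_past ltnn.
- by exists B => //; rewrite setTI.
- by apply: g_sigma_aimed; rewrite ?mem_head// => k; rewrite inE orbC => ->.
Qed.

Lemma measurable_traj i : measurable_fun setT (fun w => traj i w).
Proof. by apply: measurable_run. Qed.

Lemma measurable_aimed i : measurable_fun setT (fun w => aimed i w).
Proof. by apply: measurable_aim => //; exact: measurable_traj. Qed.

Let runRV i : {RV P >-> state} :=
  HB.pack (fun w => traj i w) (isMeasurableFun.Build _ _ _ _ _ (measurable_traj i)).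

Let aimedRV i : {RV P >-> state} :=
  HB.pack (fun w => aimed i w)
    (isMeasurableFun.Build _ _ _ _ _ (measurable_aimed i)).

Lemma target_aim f (st : state) :
  target s delta order f st = omap fst (test (aim s delta order f st)) :> option _.
Proof. by case: st => qa [[q z]|] //; rewrite /aim /=; case: target. Qed.

Section Drift.
Variables (v : state -> \bar R) (c : R).
Hypotheses (v0 : forall st, (0 <= v st)%E) (mv : measurable_fun setT v).
Hypothesis c0 : 0 <= c.
Hypothesis drift_aim :
  forall i st, (\int[P]_w v (aim s delta order (U i w) st) <= v st)%E.
Let cost (st : state) : \bar R := (if test st then c else 0)%:E.
Hypothesis drift_observe : forall st,
  (\int[normal_prob 0 1]_y v (obs st y) + cost st <= v st)%E.

Let cost0 st : (0 <= cost st)%E.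
Proof. by rewrite lee_fin; case: ifP. Qed.

Let measurable_cost : measurable_fun setT cost.
Proof. exact: measurable_testing. Qed.

Let aim_step i :
  (\int[P]_w v (aimed i w) <= \int[P]_w v (traj i w))%E.
Proof.
(* Encoded by [pickle], the selector becomes a random variable with values in [nat], whose
   sigma-algebra is discrete. *)
have mY : measurable_fun setT (fun w => pickle (U i w)).
  move=> _ A _; rewrite setTI.
  by case: UW => mU _ _ _; exact: (mU i (pickle @^-1` A)).
pose Y : {RV P >-> nat} := HB.pack (fun w => pickle (U i w))
  (isMeasurableFun.Build _ _ _ _ _ mY).
pose f (x : state * nat) : \bar R :=
  if unpickle x.2 is Some u then v (aim s delta order u x.1) else 0%E.
have fE w st : f (st, Y w) = v (aim s delta order (U i w) st).
  by rewrite /f /= pickleK.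
have f0 x : (0 <= f x)%E by rewrite /f; case: unpickle.
have mf : measurable_fun [set: state * nat] f.
  pose g (k : nat) (x : state * nat) : \bar R := f (x.1, k).
  refine (@measurable_fun_countable_cases nat _ _ (state * nat)%type _ snd _ g _ _ _).
  - move=> k; rewrite -[X in measurable X]setTI.
    exact: (@measurable_snd _ _ state nat measurableT).
  - move=> k; apply: (@measurableT_comp _ _ _ _ _ _ (fun st => f (st, k)) _ fst)
      => //.
    rewrite /f /=; case: (unpickle k) => [u|]; last exact: measurable_cst.
    apply: (measurableT_comp mv).
    apply: (@measurable_aim _ _ _ s delta order _ state (fun _ _ => u) 0%N) => //.
    move=> u'; have [->|uu'] := eqVneq u u'.
      by rewrite (_ : _ @^-1` _ = setT)// eqEsubset; split.
    rewrite (_ : _ @^-1` _ = set0)// eqEsubset; split=> // st /= /eqP.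
    by rewrite (negbTE uu').
  - by move=> [].
have := @integral_independent_le _ _ _ _ _ _ _ P (runRV i) Y f v _ mf f0 mv.
under eq_integral do rewrite fE.
apply.
- move=> A B mA _; exact: (independent_traj i (pickle @^-1` B) mA).
- move=> st.
  rewrite ge0_integral_distribution//.
  under eq_integral do rewrite /comp fE.
  exact: drift_aim.
Qed.

Let observe_step i :
  (\int[P]_w v (traj i.+1 w) + \int[P]_w cost (aimed i w)
   <= \int[P]_w v (aimed i w))%E.
Proof.
pose f (x : state * R) : \bar R := (v (obs x.1 x.2) + cost x.1)%E.
have mvo : measurable_fun [set: state * R] (fun x => v (obs x.1 x.2)).
  by apply: (measurableT_comp mv); exact: measurable_observe.
have mco : measurable_fun [set: state * R] (fun x => cost x.1).
  by apply: (measurableT_comp measurable_cost).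
have f0 x : (0 <= f x)%E by rewrite adde_ge0.
have mf : measurable_fun [set: state * R] f by exact: emeasurable_funD.
have := @integral_independent_le _ _ _ _ _ _ _ P (aimedRV i) (W i) f v _ mf f0 mv.
have fE w : f (aimedRV i w, W i w) = (v (traj i.+1 w) + cost (aimed i w))%E.
  by rewrite /f runS.
under eq_integral do rewrite fE.
rewrite ge0_integralD//; last 2 first.
- exact: (measurableT_comp mv (measurable_traj i.+1)).
- exact: (measurableT_comp measurable_cost (measurable_aimed i)).
apply.
- by move=> A B mA mB; exact: independent_aimed.
- move=> st; apply: le_trans (drift_observe st).
  rewrite (_ : (\int[_]_y _)%E = \int[normal_prob 0 1]_y f (st, y))%E.
    rewrite /f ge0_integralD//=.
      by rewrite integral_probability_cst.
    exact: (measurableT_comp mvo (pair1_measurable st)).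
  case: UW => _ _ WE _; apply: (integral_distribution_normal (WE i)) => //.
  exact: (measurableT_comp mf (pair1_measurable st)).
Qed.

(** Telescoping: aiming does not raise the mean potential, and each observation lowers it by at
    least the cost [c] times the probability that a measurement is made. With [c] = Gamma this
    bounds the expected precision; with [c] = 0 it bounds the mean of a supermartingale. *)
Lemma drift_bound N :
  (\int[P]_w v (traj N w) +
   \sum_(i < N) \int[P]_w (if target s delta order (U i w) (traj i w)
                           then c else 0)%:E
   <= v (State [::] None))%E.
Proof.
elim: N => [|N IH].
  by rewrite big_ord0 adde0 /= integral_probability_cst.
apply: le_trans IH; rewrite big_ord_recr/= [X in (_ + X)%E]addeC addeA.
apply: leeD => //; apply: le_trans (aim_step N).
apply: le_trans (observe_step N).
apply: leeD => //; rewrite (eq_integral (fun w => cost (aimed N w)))//.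
by move=> w _; rewrite target_aim /cost; case: test => [[]|].
Qed.

End Drift.

End Chain.

(** * Expected truncated distance after one normal step *)

Lemma integral_normal_expR_affine (R : realType) (c a t : R) : 0 <= c ->
  (\int[normal_prob 0 1]_x (c * expR (a + t * x))%:E =
   (c * expR (a + t ^+ 2 / 2))%:E)%E.
Proof.
move=> c0; under eq_integral do rewrite expRD mulrA EFinM.
have mt : measurable_fun setT (fun x : R => (expR (t * x))%:E).
  apply/measurable_EFinP/(measurableT_comp (@measurable_expR R)).
  by apply: measurable_funM => //.
rewrite ge0_integralZl//=; last first.
  by rewrite lee_fin mulr_ge0// expR_ge0.
by rewrite integral_expR_normal -EFinM expRD mulrA.
Qed.

(** Obtained by squaring x / 2 <= e^(x / 2). Used at x = eps / theta, where this power decay already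
    gives the order theta^2 that is needed. *)
Lemma expRN_le (R : realType) (x : R) : 0 < x -> expR (- x) <= 4 / x ^+ 2.
Proof.
move=> x0; rewrite expRN -[4 / _]invrK lef_pV2 ?posrE ?expR_gt0//; last first.
  by rewrite invr_gt0 divr_gt0// exprn_gt0.
have h : x / 2 <= expR (x / 2).
  by apply: le_trans (expR_ge1Dx _); rewrite lerDr.
have {2}-> : x = x / 2 + x / 2 by field.
rewrite expRD invf_div.
have : (x / 2) ^+ 2 <= expR (x / 2) ^+ 2.
  by rewrite lerXn2r ?nnegrE ?expR_ge0// divr_ge0// ltW.
by rewrite expr_div_n -expr2 -natrX.
Qed.

Lemma expR_le1D2x (R : realType) (x : R) : 0 <= x <= 1 / 2 -> expR x <= 1 + 2 * x.
Proof.
move=> /andP[x0 x1]; rewrite -[expR x]invrK -expRN.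
have h : 1 - x <= expR (- x) by exact: expR_ge1Dx.
have x1' : 0 < 1 - x by lra.
rewrite -[leRHS]invrK lef_pV2 ?posrE ?expR_gt0// ?invr_gt0; last by lra.
apply: le_trans h; rewrite -[leRHS]divr1 -[leLHS]div1r ler_pdivrMr; last by lra.
nra.
Qed.

(* The positive part is controlled through [max y 0 <= y + theta e^(-y/theta)],
   and the linear term through [1 + x <= e^x], so that only exponential moments
   of the normal law are needed. *)
Lemma integral_normal_max_le (R : realType) (eps b theta a : R) :
  0 < eps -> eps <= b -> 0 < theta <= 1 -> theta ^+ 2 / 2 <= eps ->
  a ^+ 2 = theta ^+ 2 ->
  (\int[normal_prob 0 1]_x (Num.max (b - theta ^+ 2 / 2 + a * x) 0)%:E <=
   (b - theta ^+ 2 / 2 + (1 + 4 * expR 1 / eps ^+ 2) * theta ^+ 3)%:E)%E.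
Proof.
move=> eps0 epsb /andP[th0 th1] theps a2.
set b' := b - theta ^+ 2 / 2.
have b'0 : 0 <= b' by rewrite subr_ge0; lra.
have thn0 : theta != 0 by rewrite gt_eqF.
pose g1 (x : R) := theta^-1 * expR (0 + theta * a * x).
pose g2 (x : R) := theta * expR (- b' / theta + - (a / theta) * x).
have g10 x : 0 <= g1 x by rewrite mulr_ge0 ?expR_ge0 ?invr_ge0// ltW.
have g20 x : 0 <= g2 x by rewrite mulr_ge0 ?expR_ge0// ltW.
(* The constant 1 / theta is carried on both sides so that the linear term, which has no sign, can
   be replaced by the non-negative [g1]; [g2] dominates the negative part of b' + a x. *)
have max_le x : Num.max (b' + a * x) 0 + theta^-1 <= b' + (g1 x + g2 x).
  have h1 : a * x + theta^-1 <= g1 x.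
    rewrite /g1 add0r -(@ler_pM2l _ theta)// mulrA divff// mul1r.
    apply: le_trans (expR_ge1Dx _).
    by rewrite mulrDr divff// addrC mulrA.
  have h2 : Num.max (b' + a * x) 0 <= b' + a * x + g2 x.
    have g2x := g20 x; have [y0|y0] := leP (b' + a * x) 0; last by rewrite lerDl.
    have : - (b' + a * x) / theta <= expR (- b' / theta + - (a / theta) * x).
      apply: le_trans (expR_ge1Dx _).
      rewrite (_ : _ + - (a / theta) * x = - (b' + a * x) / theta) ?lerDr//.
      by field.
    rewrite ler_pdivrMr// [_ * theta]mulrC -/(g2 x) -subr_ge0 opprK addrC.
    by [].
  move: (Num.max _ _) (g1 x) (g2 x) h1 h2 => M u1 u2 h1 h2.
  by clear -h1 h2; lra.
have mg (c t r : R) : measurable_fun setT (fun x : R => (c * expR (t + r * x))%:E).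
  apply/measurable_EFinP/measurable_funM => //.
  apply: (measurableT_comp (@measurable_expR R)).
  by apply: measurable_funD => //; apply: measurable_funM.
have mmax : measurable_fun setT (fun x : R => (Num.max (b' + a * x) 0)%:E).
  apply/measurable_EFinP/measurable_maxr => //.
  by apply: measurable_funD => //; apply: measurable_funM.
have cst_int (c : R) : (\int[normal_prob 0 1]_(_ in [set: R]) c%:E = c%:E)%E.
  exact: integral_probability_cst.
have max0 x : (0 <= (Num.max (b' + a * x) 0)%:E)%E.
  by rewrite lee_fin le_max lexx orbT.
have : (\int[normal_prob 0 1]_x ((Num.max (b' + a * x) 0)%:E + theta^-1%:E) <=
    \int[normal_prob 0 1]_x (b'%:E + ((g1 x)%:E + (g2 x)%:E)))%E.
  apply: ge0_le_integral => //.
  - by move=> x _; rewrite adde_ge0// lee_fin invr_ge0 ltW.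
  - exact: emeasurable_funD.
  - by apply: emeasurable_funD => //; apply: emeasurable_funD; exact: mg.
  - by move=> x _; rewrite -!EFinD lee_fin max_le.
rewrite ge0_integralD//; last by move=> x _; rewrite lee_fin invr_ge0 ltW.
rewrite ge0_integralD//; last 2 first.
- by move=> x _; rewrite adde_ge0// lee_fin.
- by apply: emeasurable_funD; exact: mg.
rewrite ge0_integralD//; last 4 first.
- by move=> x _; rewrite lee_fin.
- exact: mg.
- by move=> x _; rewrite lee_fin.
- exact: mg.
have th0' := ltW th0.
rewrite !cst_int !integral_normal_expR_affine ?invr_ge0//.
rewrite -leeBrDr// => /le_trans; apply; rewrite -!EFinD lee_fin.
have h1 : expR (0 + (theta * a) ^+ 2 / 2) <= 1 + theta ^+ 4.
  rewrite add0r exprMn a2 -exprD.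
  have t4 : 0 <= theta ^+ 4 <= 1 by rewrite exprn_ge0 ?exprn_ile1// ltW.
  by apply: le_trans (expR_le1D2x _) _; lra.
(* The truncation is rarely active: [b] is at least [eps], while one step has standard deviation
   theta. The exponent equals theta / 2 + 1 / 2 - b / theta, hence is at most 1 - eps / theta. *)
have h2 : expR (- b' / theta + (- (a / theta)) ^+ 2 / 2) <=
    expR 1 * (4 * theta ^+ 2 / eps ^+ 2).
  rewrite sqrrN expr_div_n a2 divff ?expf_neq0//.
  rewrite (_ : - b' / theta + 1 / 2 = (theta / 2 + 1 / 2) + - (b / theta)); last first.
    by rewrite /b'; field.
  rewrite expRD ler_pM ?expR_ge0//; first by rewrite ler_expR; lra.
  apply: le_trans (_ : expR (- (eps / theta)) <= _).
    by rewrite ler_expR lerN2 ler_pM2r ?invr_gt0.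
  apply: le_trans (expRN_le _) _; first by rewrite divr_gt0.
  by rewrite expr_div_n invf_div mulrA.
have h1' : theta^-1 * expR (0 + (theta * a) ^+ 2 / 2) <= theta^-1 + theta ^+ 3.
  apply: le_trans (ler_wpM2l _ h1) _; first by rewrite invr_ge0 ltW.
  by rewrite mulrDr mulr1 (exprS _ 3) mulrA mulVf// mul1r.
have h2' : theta * expR (- b' / theta + (- (a / theta)) ^+ 2 / 2) <=
    4 * expR 1 / eps ^+ 2 * theta ^+ 3.
  apply: le_trans (ler_wpM2l _ h2) _; first exact: ltW.
  by rewrite le_eqVlt; apply/orP; left; apply/eqP; field; rewrite gt_eqF.
lra.
Qed.

(** * Queries and consistent submatrices *)

Section Combinatorics.
Variables (R : realType) (n1 n2 s : nat) (delta : R).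
Local Notation cell := (cell n1 n2).
Implicit Types (qa : seq (cell * bool)) (q c : cell) (S : {set cell}).

Lemma in_unqueried qa q : (q \in unqueried qa) = (q \notin [seq a.1 | a <- qa]).
Proof. by rewrite finset.in_set. Qed.

Lemma unqueried_rcons qa q b :
  unqueried (rcons qa (q, b)) = (unqueried qa :\ q)%SET.
Proof.
by apply/setP => x; rewrite finset.in_setD1 !in_unqueried map_rcons mem_rcons inE negb_or.
Qed.

Lemma card_setI_unqueried_rcons (A : {set cell}) qa q b : q \in unqueried qa ->
  #|A :&: unqueried (rcons qa (q, b))|%SET%:R =
  #|A :&: unqueried qa|%SET%:R - (q \in A)%:R :> R.
Proof.
move=> uq; rewrite unqueried_rcons (cardsD1 q (A :&: unqueried qa)%SET).
rewrite finset.in_setI uq andbT natrD addrAC subrr add0r.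
by congr (#|pred_of_set _|%:R); apply/setP => x; rewrite !inE andbCA.
Qed.

Lemma found_rcons qa q b : found (rcons qa (q, b)) =
  if found qa is Some c then Some c else if b then Some q else None.
Proof.
rewrite /found filter_rcons /= fun_if map_rcons /=.
by case: [seq x <- qa | x.2] b => [|[? ?] ?] [].
Qed.

Lemma found_mem qa c : found qa = Some c -> (c, true) \in qa.
Proof.
rewrite /found; case E : [seq a <- qa | a.2] => [|[x []] r]//= [<-].
  by have := mem_head (x, true) r; rewrite -E mem_filter => /andP[].
by have := mem_head (x, false) r; rewrite -E mem_filter.
Qed.

Lemma found_None qa a : found qa = None -> a \in qa -> a.2 = false.
Proof.
rewrite /found; case E : [seq a <- qa | a.2] => [|? ?]// _ aqa.
apply/negbTE/negP => a2; have : a \in [seq a <- qa | a.2].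
  by rewrite mem_filter a2.
by rewrite E.
Qed.

Lemma in_consistent S qa : (S \in consistent s qa) =
  (S \in submatrices n1 n2 s) && all (fun a => a.2 == (a.1 \in S)) qa.
Proof. by rewrite finset.in_set. Qed.

Lemma consistent_agree S S' qa q b :
  S \in consistent s qa -> S' \in consistent s qa -> (q, b) \in qa ->
  (q \in S) = (q \in S').
Proof.
rewrite !in_consistent => /andP[_ /allP hS] /andP[_ /allP hS'] qqa.
by have /eqP <- := hS _ qqa; have /eqP <- := hS' _ qqa.
Qed.

Lemma queriedP qa q : reflect (exists b, (q, b) \in qa) (q \notin unqueried qa).
Proof.
rewrite in_unqueried negbK; apply: (iffP mapP) => [[[x b] xqa /= ->]|[b qqa]].
  by exists b.
by exists (q, b).
Qed.

(** A product set is determined by its row and its column through any one of its cells; this is why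
    the refinement phase identifies the support. *)
Lemma submatrix_mem S i j i' j' : S \in submatrices n1 n2 s ->
  (i, j) \in S -> (i', j') \in S = ((i', j) \in S) && ((i, j') \in S).
Proof.
rewrite inE => /existsP[S1 /existsP[S2 /andP[/eqP -> _]]].
by rewrite !inE /= => /andP[-> ->]; rewrite andbT.
Qed.

Lemma card_submatrix S : S \in submatrices n1 n2 s -> #|S| = s.
Proof.
rewrite inE => /existsP[S1 /existsP[S2 /andP[/eqP -> /eqP <-]]].
exact: cardsX.
Qed.

(** Every consistent submatrix contains [c], whose answer is 1, so it is determined by its trace on
    the cross, and the answers prescribe that trace. Hence the refinement phase never runs out of
    cells before stopping. *)
Lemma stopped_cross_queried qa c : found qa = Some c ->
  (forall q, q \in cross c -> q \notin unqueried qa) -> stopped s delta qa.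
Proof.
move=> fc hc; have cqa := found_mem fc.
rewrite /stopped; apply/andP; split; first by case: (qa) cqa.
apply/orP; left; apply/card_le1_eqP => S S' SC S'C.
have cS S0 : S0 \in consistent s qa -> c \in S0.
  by rewrite in_consistent => /andP[_ /allP/(_ _ cqa)/eqP <-].
have agree q : q \in cross c -> (q \in S) = (q \in S').
  by move=> /hc/queriedP[b]; exact: consistent_agree.
apply/setP => -[i j]; have := cS _ SC; have := cS _ S'C.
case: c {fc hc cqa cS} agree => ci cj agree cS' cS.
have subm S0 : S0 \in consistent s qa -> S0 \in submatrices n1 n2 s.
  by rewrite in_consistent => /andP[].
rewrite (submatrix_mem i j (subm _ SC) cS) (submatrix_mem i j (subm _ S'C) cS').
by rewrite !agree// inE /= eqxx ?orbT.
Qed.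

(** Ensures that a search query is drawn from a nonempty set, the case in which the selector has a
    prescribed law. *)
Lemma stopped_all_queried qa : (0 < n1)%N -> (0 < n2)%N ->
  unqueried qa = finset.set0 -> stopped s delta qa.
Proof.
move=> n10 n20 uq0.
have hq q : q \notin unqueried qa by rewrite uq0 inE.
rewrite /stopped; apply/andP; split.
  have /queriedP[b] := hq (Ordinal n10, Ordinal n20).
  by case: (qa).
apply/orP; left; apply/card_le1_eqP => S S' SC S'C.
by apply/setP => q; have /queriedP[b] := hq q; exact: consistent_agree.
Qed.

Lemma next_query_cross (order : cell -> seq cell) f qa c :
  (forall c, order c =i cross c) -> ~~ stopped s delta qa -> found qa = Some c ->
  exists q, [/\ next_query s delta order f qa = Some q, q \in unqueried qa
    & q \in cross c].
Proof.
move=> hord nst fc; rewrite /next_query (negbTE nst) fc.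
case E : [seq q <- order c | q \in unqueried qa] => [|q r].
  case/negP: nst; apply: (stopped_cross_queried fc) => q qc.
  apply/negP => uq; have : q \in [seq q <- order c | q \in unqueried qa].
    by rewrite mem_filter uq hord.
  by rewrite E.
exists q; split=> //.
  by have := mem_head q r; rewrite -E mem_filter => /andP[].
by have := mem_head q r; rewrite -E mem_filter hord => /andP[].
Qed.

(** A run that has not stopped always makes a further measurement and pays Gamma for it, so a finite
    budget will force it to stop. *)
Lemma target_not_stopped (order : cell -> seq cell) f (st : state R n1 n2) :
  (forall c, order c =i cross c) -> ~~ stopped s delta (answers st) ->
  isSome (target s delta order f st).
Proof.
move=> hord; case: st => qa [[q z]|]//= nst; rewrite /target /=.
case fc : (found qa) => [c|].
  by have [q [-> _ _]] := next_query_cross f hord nst fc.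
by rewrite /next_query (negbTE nst) fc.
Qed.

Lemma card_cross c : (#|cross c| <= n1 + n2)%N.
Proof.
have -> : cross c = ([set (c.1, j) | j in [set: 'I_n2]] :|:
    [set (i, c.2) | i in [set: 'I_n1]])%SET.
  apply/setP => -[i j]; rewrite !inE /=; apply/orP/orP => -[].
  - by move=> /eqP ->; left; apply/imsetP; exists j; rewrite ?inE.
  - by move=> /eqP ->; right; apply/imsetP; exists i; rewrite ?inE.
  - by move=> /imsetP[k _ [-> _]]; left.
  - by move=> /imsetP[k _ [_ ->]]; right.
apply: leq_trans (leq_card_setU _ _) _; rewrite addnC.
by rewrite leq_add// (leq_trans (leq_imset_card _ _))// cardsT card_ord.
Qed.

End Combinatorics.

Lemma integral_selector d (T : measurableType d) (R : realType)
    (P : probability T R) (n1 n2 : nat) (U : nat -> T -> selector n1 n2)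
    (W : nat -> {RV P >-> R}) i (A : {set cell n1 n2})
    (g : cell n1 n2 -> \bar R) :
  sensing_model U W -> A != finset.set0 -> (forall q, 0 <= g q)%E ->
  (\int[P]_w g (U i w A) = \sum_(q in A) (#|A|%:R^-1)%:E * g q)%E.
Proof.
move=> [mU PU _ _] A0 g0.
pose E q := [set w | U i w A = q].
have mE q : measurable (E q) by exact: (mU i [set f : selector n1 n2 | f A = q]).
have intE (h : cell n1 n2 -> \bar R) : (forall q, 0 <= h q)%E ->
    (\int[P]_w h (U i w A) = \sum_q h q * P (E q))%E.
  move=> h0.
  transitivity (\int[P]_w \sum_q h q * (\1_(E q) w)%:E)%E.
    apply: eq_integral => w _.
    rewrite (bigD1 (U i w A))//= indicE mem_set// mule1 big1 ?adde0// => q qU.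
    rewrite indicE memNset ?mule0// => /esym/eqP.
    by rewrite (negbTE qU).
  have mI q : measurable_fun setT (fun w => (\1_(E q) w)%:E : \bar R).
    exact/measurable_EFinP/measurable_indic.
  have mhI q : measurable_fun setT (fun w => h q * (\1_(E q) w)%:E)%E.
    exact: emeasurable_funM.
  have hI0 q w : (0 <= h q * (\1_(E q) w)%:E)%E by rewrite mule_ge0// lee_fin.
  rewrite ge0_integral_sum//.
  apply: eq_bigr => q _; rewrite ge0_integralZl//.
  by rewrite integral_indic// setIT.
have sumA : (\sum_(q in A) P (E q) = 1)%E.
  rewrite (eq_bigr (fun=> (#|A|%:R^-1)%:E)) => [|q qA]; last exact: PU.
  rewrite sumEFin sumr_const; congr EFin; rewrite -[LHS]mulr_natr mulVf//.
  by rewrite pnatr_eq0 cards_eq0.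
(* The model prescribes probabilities only for the elements of [A]. They already sum to 1, so
   integrating the constant 1 shows that the other values are null. *)
have P0 q : q \notin A -> P (E q) = 0%E.
  have := intE (fun=> 1%E) (fun=> lee01).
  rewrite integral_probability_cst (bigID (mem A))/=.
  under eq_bigr do rewrite mul1e.
  under [in X in (_ + X)%E]eq_bigr do rewrite mul1e.
  rewrite sumA => sum1 qA; apply/eqP; rewrite eq_le measure_ge0 andbT.
  rewrite -(@leeD2lE _ 1%E)// adde0 {2}sum1.
  apply: leeD => //; rewrite (bigD1 q)//= leeDl// sume_ge0//.
rewrite intE// (bigID (mem A))/= [X in (_ + X)%E]big1 ?adde0.
  by apply: eq_bigr => q qA; rewrite muleC; congr (_ * _)%E; exact: PU.
by move=> q qA; rewrite P0// mule0.
Qed.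

(** * Expected precision *)

Section LogLikelihood.
Variables (R : realType) (n1 n2 s : nat) (delta mu Gamma : R).
Variable S : {set cell n1 n2}.
Local Notation state := (state R n1 n2).
Hypothesis Gamma_gt0 : 0 < Gamma.

(** Standard deviation of one increment of the log-likelihood ratio. The mean of the increment is
    plus or minus half its square, so this single parameter governs both drift and fluctuation. *)
Definition llr_sd : R := Num.sqrt Gamma * mu.

Definition llr_step (q : cell n1 n2) (w : R) : R :=
  (if q \in S then llr_sd ^+ 2 / 2 else - (llr_sd ^+ 2 / 2)) + llr_sd * w.

Lemma llr_signal q w :
  llr mu Gamma (signal mu S q + noise_sd Gamma * w) = llr_step q w.
Proof.
rewrite llrE// /llr_step /llr_sd /signal /noise_sd.
have sG : Num.sqrt Gamma != 0 by rewrite gt_eqF// sqrtr_gt0.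
have GE : Gamma = Num.sqrt Gamma ^+ 2 by rewrite sqr_sqrtr// ltW.
by move: (Num.sqrt Gamma) GE sG => r -> r0; case: ifP => _; field.
Qed.

(** One function [p] of the new log-likelihood ratio dominates the potential in all three outcomes
    of an observation; the drift estimates then reduce to explicit normal integrals of [p]. *)
Lemma observe_le (v : state -> \bar R) (p : R -> \bar R)
    (qa : seq (cell n1 n2 * bool)) (q : cell n1 n2) (z w : R) :
  (forall y, upper s delta qa <= y ->
    (v (State (rcons qa (q, true)) None) <= p y)%E) ->
  (forall y, y <= lower s delta qa ->
    (v (State (rcons qa (q, false)) None) <= p y)%E) ->
  (forall y, lower s delta qa < y < upper s delta qa ->
    (v (State qa (Some (q, y))) <= p y)%E) ->
  (v (observe s delta mu Gamma S (State qa (Some (q, z))) w)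
   <= p (z + llr_step q w)%R)%E.
Proof.
move=> hu hl hm; rewrite /observe /update /= llr_signal.
case: (leP (upper s delta qa)) => [|yu]; first exact: hu.
case: (leP _ (lower s delta qa)) => [|yl]; first exact: hl.
by apply: hm; rewrite yl.
Qed.

End LogLikelihood.

Section CostBound.
Context d (T : measurableType d) (R : realType) (P : probability T R).
Variables (n1 n2 : nat) (U : nat -> T -> selector n1 n2) (W : nat -> {RV P >-> R}).
Hypothesis UW : sensing_model U W.
Variables (s : nat) (delta mu Gamma : R) (order : cell n1 n2 -> seq (cell n1 n2)).
Variable S : {set cell n1 n2}.
Hypotheses (n1_gt0 : (0 < n1)%N) (n2_gt0 : (0 < n2)%N) (s_gt0 : (0 < s)%N).
Hypothesis order_cross : forall c, order c =i cross c.
Hypothesis SC : S \in submatrices n1 n2 s.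
Hypothesis Gamma_gt0 : 0 < Gamma.
Hypothesis delta_itv : 0 < delta < 1.

Local Notation state := (state R n1 n2).
Local Notation n := (n1 * n2)%N.
Local Notation theta := (llr_sd mu Gamma).

Lemma s_le_n : (s <= n)%N.
Proof.
rewrite -(card_submatrix SC) (leq_trans (max_card _))//.
by rewrite card_prod !card_ord.
Qed.

(** [c] is the expected precision spent per unit of distance to the correct boundary. [A1], [As] and
    [Ar] bound the cost of a test of a support coordinate, of a null coordinate in the search, and
    of a null coordinate in the refinement. [c_drift] says that the mean decrease of the distance
    pays for one measurement. *)
Variables (eps c As Ar A1 : R).
Hypotheses (As0 : 0 <= As) (Ar0 : 0 <= Ar) (A10 : 0 <= A1) (c0 : 0 <= c).
Hypotheses (eps0 : 0 < eps) (theta01 : 0 < theta <= 1)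
  (theta_eps : theta ^+ 2 / 2 <= eps).
Hypothesis c_drift :
  Gamma <= c * (theta ^+ 2 / 2 - (1 + 4 * expR 1 / eps ^+ 2) * theta ^+ 3).
Hypothesis lower0 : forall qa : seq (cell n1 n2 * bool), lower s delta qa < 0.
Hypothesis upper0 : forall qa : seq (cell n1 n2 * bool), 0 < upper s delta qa.
Hypothesis costA1 : forall qa : seq (cell n1 n2 * bool),
  c * (upper s delta qa + eps) <= A1.
Hypothesis costA0 : forall qa : seq (cell n1 n2 * bool),
  c * (eps - lower s delta qa) <= if found qa is Some _ then Ar else As.

Local Notation J := (max_search n1 n2 s delta).
Implicit Types (qa : seq (cell n1 n2 * bool)) (q : cell n1 n2).

Let unS qa : R := #|S :&: unqueried qa|%SET%:R.
Let unC qa x : R := #|cross x :&: unqueried qa|%SET%:R.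

(* The first query hits the support with probability [s / n], which pays for
   rounding [J] up to an integer. *)
Definition search_left qa : R :=
  if qa is [::] then J + 1 - s%:R / n%:R else J + 1 - (size qa)%:R.

Definition cost_left qa : R :=
  A1 * unS qa +
  if found qa is Some x then Ar * unC qa x
  else As * search_left qa + Ar * (n1 + n2)%:R.

(** Bounds the remaining cost for both answers to the test of [q]. A false alarm does no harm: it
    opens the refinement phase, whose cost [Ar] times n_1 + n_2 is already reserved. *)
Definition cost_left_after qa q : R :=
  A1 * (unS qa - (q \in S)%:R) +
  if found qa is Some x then Ar * (unC qa x - 1)
  else As * (J - (size qa)%:R) + Ar * (n1 + n2)%:R.

Definition test_cost qa q z : R :=
  c * Num.max ((if q \in S then upper s delta qa - z
                else z - lower s delta qa) + eps) 0.

Definition testable qa q : bool :=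
  [&& q \in unqueried qa, ~~ stopped s delta qa
    & if found qa is Some x then q \in cross x else true].

(* Bounds the expected precision still to be spent.  For the test in progress this
   is proportional to the distance to the correct boundary, enlarged by [eps] to
   pay for the overshoot; [+oo] marks states that are almost surely not reached. *)
Definition cost_potential (st : state) : \bar R :=
  match test st with
  | None => (if stopped s delta (answers st) then 0 else cost_left (answers st))%:E
  | Some (q, z) =>
    if testable (answers st) q &&
      (lower s delta (answers st) < z < upper s delta (answers st))
    then (test_cost (answers st) q z + cost_left_after (answers st) q)%:E
    else +oo%E
  end.

Let J_gt0 : 0 < J.
Proof.
have /andP[d0 d1] := delta_itv.
rewrite mulr_gt0 ?divr_gt0 ?ltr0n ?muln_gt0 ?n1_gt0//.
by rewrite ln_gt0// ltr_pdivlMr//; lra.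
Qed.

Let not_exhausted qa : ~~ stopped s delta qa -> found qa = None ->
  (size qa)%:R < J.
Proof.
rewrite /stopped /exhausted => + fN; rewrite fN eqxx /=.
case: qa {fN} => [_ /=|a qa]; first exact: J_gt0.
by rewrite /= negb_or -ltNge => /andP[].
Qed.

Let unS_after qa q b : q \in unqueried qa ->
  unS (rcons qa (q, b)) = unS qa - (q \in S)%:R.
Proof. exact: card_setI_unqueried_rcons. Qed.

Let unC_after qa q b x : q \in unqueried qa -> q \in cross x ->
  unC (rcons qa (q, b)) x = unC qa x - 1.
Proof.
by move=> uq qx; rewrite /unC (card_setI_unqueried_rcons R _ _ uq) qx.
Qed.

Let unC_le qa x : unC qa x <= (n1 + n2)%:R.
Proof.
rewrite ler_nat (leq_trans (subset_leq_card (finset.subsetIl _ _)))//.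
exact: card_cross.
Qed.

Let after_ge0 qa q : testable qa q -> 0 <= cost_left_after qa q.
Proof.
move=> /and3P[uq nst]; rewrite /cost_left_after -(unS_after false uq).
case fq : (found qa) => [x|] qx.
  by rewrite -(unC_after false uq qx) addr_ge0// mulr_ge0.
rewrite !addr_ge0// !mulr_ge0// subr_ge0 ltW//.
exact: not_exhausted.
Qed.

Let search_left_rcons qa a : search_left (rcons qa a) = J - (size qa)%:R.
Proof.
rewrite (_ : search_left _ = J + 1 - (size (rcons qa a))%:R); last by case: qa.
by rewrite size_rcons -natr1; ring.
Qed.

Let left_after qa q b : testable qa q ->
  (if stopped s delta (rcons qa (q, b)) then 0 else cost_left (rcons qa (q, b)))
  <= cost_left_after qa q.
Proof.
move=> tq; case: ifP => _; first exact: after_ge0.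
have /and3P[uq nst qx] := tq.
rewrite /cost_left /cost_left_after (unS_after b uq) lerD2l found_rcons.
move: qx; case fq : (found qa) => [x|] qx; first by rewrite (unC_after b uq qx).
have JJ : 0 <= As * (J - (size qa)%:R).
  by rewrite mulr_ge0// subr_ge0 ltW// not_exhausted.
case: b.
  have := ler_wpM2l Ar0 (unC_le (rcons qa (q, true)) q); lra.
rewrite lerD2r ler_wpM2l// search_left_rcons; lra.
Qed.

Let search_left_ge0 qa : ~~ stopped s delta qa -> found qa = None ->
  0 <= search_left qa.
Proof.
move=> nst fq; have := not_exhausted nst fq; rewrite /search_left.
case: qa nst fq => [|a qa] _ _ h; last by rewrite subr_ge0 ler_wpDr// ltW.
rewrite -addrA addr_ge0 ?(ltW J_gt0)// subr_ge0 ler_pdivrMr ?mul1r ?ler_nat.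
  exact: s_le_n.
by rewrite ltr0n muln_gt0 n1_gt0.
Qed.

Let cost_left_ge0 qa : ~~ stopped s delta qa -> 0 <= cost_left qa.
Proof.
move=> nst; rewrite /cost_left addr_ge0 ?mulr_ge0//.
case fq : (found qa) => [x|]; first by rewrite mulr_ge0.
by rewrite addr_ge0 ?mulr_ge0// search_left_ge0.
Qed.

Let test_cost_ge0 qa q z : 0 <= test_cost qa q z.
Proof. by rewrite mulr_ge0// le_max lexx orbT. Qed.

Lemma cost_potential_ge0 st : (0 <= cost_potential st)%E.
Proof.
case: st => qa [[q z]|]; rewrite /cost_potential /=.
  by case: ifP => // /andP[tq _]; rewrite lee_fin addr_ge0// after_ge0.
by rewrite lee_fin; case: ifPn => // nst; exact: cost_left_ge0.
Qed.

Lemma measurable_test_cost qa q : measurable_fun setT (test_cost qa q).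
Proof.
rewrite /test_cost; apply: measurable_funM => //; apply: measurable_maxr => //.
by apply: measurable_funD => //; case: (q \in S); exact: measurable_funB.
Qed.

Lemma measurable_cost_potential : measurable_fun setT cost_potential.
Proof.
pose g (a : seq (cell n1 n2 * bool) * option (cell n1 n2)) (st : state) :=
  cost_potential (state_of a (state_value st)).
refine (@measurable_fun_countable_cases _ _ _ state _ (@state_shape R n1 n2) _ g _ _ _).
- exact: measurable_state_shape.
- move=> [qa [q|]]; rewrite /g /cost_potential /=; last exact: measurable_cst.
  have mz := @measurable_state_value R n1 n2.
  apply: measurable_fun_ifT => //.
    apply: measurable_and => //; apply: measurable_and;
    exact: measurable_fun_ltr.
  apply/measurable_EFinP/measurable_funD => //.
  exact: (measurableT_comp (measurable_test_cost qa q) mz).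
- by move=> st; rewrite /g state_ofK.
Qed.

(** Inside the interval the enlarged distance [b] is at least [eps], so [integral_normal_max_le]
    applies, and [c_drift] turns the decrease into Gamma. Leaving by either boundary is covered
    because the truncated distance is non-negative. *)
Lemma cost_drift_observe (st : state) :
  (\int[normal_prob 0 1]_y cost_potential (observe s delta mu Gamma S st y) +
   (if test st then Gamma else 0)%:E <= cost_potential st)%E.
Proof.
case: st => qa [[q z]|]; last first.
  by rewrite /observe /= integral_probability_cst adde0.
rewrite {2}/cost_potential /=; case: ifPn => [/andP[tq zlu]|_]; last exact: leey.
set C := cost_left_after qa q.
have C0 : 0 <= C by exact: after_ge0.
pose a := if q \in S then - theta else theta.
pose b := (if q \in S then upper s delta qa - z else z - lower s delta qa) + eps.
have a2 : a ^+ 2 = theta ^+ 2 by rewrite /a; case: ifP; rewrite ?sqrrN.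
have epsb : eps <= b.
  by rewrite /b; case/andP: zlu => ? ?; case: ifP => _; lra.
have maxE y : test_cost qa q (z + llr_step mu Gamma S q y) =
    c * Num.max (b - theta ^+ 2 / 2 + a * y) 0.
  rewrite /test_cost /llr_step /b /a.
  by case: ifP => qS; rewrite ?qS; congr (c * Num.max _ _); ring.
have le_obs y : (cost_potential (observe s delta mu Gamma S
    (State qa (Some (q, z))) y) <=
    c%:E * (Num.max (b - theta ^+ 2 / 2 + a * y) 0)%:E + C%:E)%E.
  pose p y := (test_cost qa q y + C)%:E.
  have := @observe_le _ _ _ s delta mu Gamma S Gamma_gt0 cost_potential p qa q z y.
  rewrite /p maxE EFinD EFinM; apply.
  - move=> y' _; rewrite /cost_potential /= lee_fin.
    by rewrite (le_trans (left_after true tq))// lerDr.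
  - move=> y' _; rewrite /cost_potential /= lee_fin.
    by rewrite (le_trans (left_after false tq))// lerDr.
  - by move=> y' ylu; rewrite /cost_potential /= tq ylu.
have mmax : measurable_fun setT (fun x : R =>
    (Num.max (b - theta ^+ 2 / 2 + a * x) 0)%:E).
  apply/measurable_EFinP/measurable_maxr => //.
  by apply: measurable_funD => //; apply: measurable_funM.
have max0 x : (0 <= (Num.max (b - theta ^+ 2 / 2 + a * x) 0)%:E)%E.
  by rewrite lee_fin le_max lexx orbT.
have mobs : measurable_fun setT (fun y => cost_potential
    (observe s delta mu Gamma S (State qa (Some (q, z))) y)).
  have mvo := measurableT_comp measurable_cost_potential
    (measurable_observe s delta mu S Gamma_gt0).
  exact: (measurableT_comp mvo (pair1_measurable (State qa (Some (q, z))))).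
have mcmax := emeasurable_funM (measurable_cst c%:E) mmax.
have intle : (\int[normal_prob 0 1]_y cost_potential (observe s delta mu Gamma S
      (State qa (Some (q, z))) y) <=
    \int[normal_prob 0 1]_y (c%:E * (Num.max (b - theta ^+ 2 / 2 + a * y) 0)%:E
      + C%:E))%E.
  apply: ge0_le_integral => //.
  - by move=> y _; exact: cost_potential_ge0.
  - exact: emeasurable_funD.
apply: le_trans (leeD intle (lexx _)) _.
rewrite ge0_integralD//=; last by move=> x _; rewrite mule_ge0// lee_fin.
rewrite ge0_integralZl// integral_probability_cst.
have := integral_normal_max_le eps0 epsb theta01 theta_eps a2.
move=> /(lee_wpmul2l (_ : (0 <= c%:E)%E)); rewrite lee_fin => /(_ c0) h.
apply: le_trans (leeD (leeD h (lexx _)) (lexx _)) _.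
rewrite -EFinM -!EFinD lee_fin.
have -> : test_cost qa q z = c * b.
  by rewrite /test_cost -/b max_l// ltW// (lt_le_trans eps0).
move: c_drift; rewrite !mulrDr mulrN; lra.
Qed.

Let mul_max_le b A : 0 <= A -> c * b <= A -> c * Num.max b 0 <= A.
Proof. by move=> A0 cA; case: (leP b 0) => _ //; rewrite mulr0. Qed.

Let test_cost_start qa q : test_cost qa q 0 <=
  if q \in S then A1 else if found qa is Some _ then Ar else As.
Proof.
rewrite /test_cost; case: ifP => qS; apply: mul_max_le => //.
- by rewrite subr0.
- by case: found.
- by rewrite sub0r addrC.
Qed.

Let testable_lu qa q : testable qa q ->
  cost_potential (State qa (Some (q, 0))) =
  (test_cost qa q 0 + cost_left_after qa q)%:E.
Proof. by move=> tq; rewrite /cost_potential /= tq lower0 upper0. Qed.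

Let measurable_aim_cst i st :
  measurable_fun setT (fun w => aim s delta order (U i w) st).
Proof.
apply: (@measurable_aim _ _ _ s delta order _ T U i (fun=> st)) => //.
by move=> f; case: UW => mU _ _ _; exact: mU.
Qed.

Let start_le_search qa q : testable qa q -> found qa = None ->
  test_cost qa q 0 + cost_left_after qa q <=
  A1 * unS qa + As * (J - (size qa)%:R + (q \notin S)%:R) + Ar * (n1 + n2)%:R.
Proof.
move=> tq fq; have := test_cost_start qa q.
rewrite /cost_left_after fq; case: (q \in S) => /=; lra.
Qed.

Let card_unS0 : unS [::] = s%:R.
Proof.
rewrite /unS -(card_submatrix SC); congr (#|pred_of_set _|%:R).
by apply/setP => q; rewrite !inE andbT.
Qed.

(** At the first query the proportion of null coordinates is exactly 1 - s / n, the discount built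
    into [search_left]; at later queries it is simply bounded by 1. *)
Let search_average qa : ~~ stopped s delta qa -> found qa = None ->
  \sum_(q in unqueried qa) #|unqueried qa|%:R^-1 *
     (A1 * unS qa + As * (J - (size qa)%:R + (q \notin S)%:R)
      + Ar * (n1 + n2)%:R) <= cost_left qa.
Proof.
move=> nst fq.
have u0 : #|unqueried qa|%:R != 0 :> R.
  rewrite pnatr_eq0 cards_eq0; apply: contra nst => /eqP.
  exact: stopped_all_queried.
have avg (r : R) : \sum_(q in unqueried qa) #|unqueried qa|%:R^-1 * r = r.
  by rewrite sumr_const -mulrnAl -mulr_natr mulVf// mul1r.
rewrite /cost_left fq /search_left; case: qa nst fq u0 avg => [|a qa] nst fq u0 avg.
  set A : {set cell n1 n2} := unqueried [::].
  pose base := A1 * unS [::] + As * J + Ar * (n1 + n2)%:R.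
  rewrite [X in X <= _](_ : _ = \sum_(q in A) (#|A|%:R^-1 *
      base + As * (#|A|%:R^-1 * (q \notin S)%:R))); last first.
    by apply: eq_bigr => q _; rewrite /base subr0; ring.
  rewrite big_split/= avg -!mulr_sumr.
  have cT : #|A| = n.
    rewrite (_ : A = [set: cell n1 n2]%SET).
      by rewrite cardsT card_prod !card_ord.
    by apply/setP => q; rewrite /A !inE.
  have -> : \sum_(q in A) (q \notin S)%:R = n%:R - s%:R :> R.
    transitivity (#|(~: S)%SET|%:R : R).
      rewrite -sum1_card natr_sum [RHS]big_mkcond [LHS]big_mkcond/=.
      by apply: eq_bigr => q _; rewrite !inE; case: (q \in S).
    have := cardsC S; rewrite card_prod !card_ord (card_submatrix SC) => <-.
    by rewrite natrD addrAC subrr add0r.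
  rewrite cT in u0 *.
  by rewrite mulrBr mulVf// [_^-1 * _]mulrC /base; lra.
rewrite -[X in _ <= X]avg.
apply: ler_sum => q _; rewrite ler_wpM2l ?invr_ge0//.
have : As * (q \notin S)%:R <= As by case: (q \in S); rewrite ?mulr1 ?mulr0.
lra.
Qed.

Lemma cost_drift_aim i st :
  (\int[P]_w cost_potential (aim s delta order (U i w) st) <= cost_potential st)%E.
Proof.
case: st => qa [[q z]|]; first by rewrite /aim /= integral_probability_cst.
have [st|nst] := boolP (stopped s delta qa).
  by rewrite /aim /= /target /next_query st /= integral_probability_cst.
case fq : (found qa) => [x|]; last first.
  have u0 : unqueried qa != finset.set0.
    by apply: contra nst => /eqP; exact: stopped_all_queried.
  have aimE w : cost_potential (aim s delta order (U i w) (State qa None)) =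
      cost_potential (State qa (Some (U i w (unqueried qa), 0))).
    by rewrite /aim /= /target /next_query (negbTE nst) fq.
  under eq_integral do rewrite aimE.
  rewrite (integral_selector i UW u0 (fun q => cost_potential_ge0 (State qa (Some (q, 0))))).
  rewrite [leRHS]/cost_potential /= (negbTE nst).
  apply: le_trans (_ : (\sum_(q in unqueried qa) (#|unqueried qa|%:R^-1 *
     (A1 * unS qa + As * (J - (size qa)%:R + (q \notin S)%:R)
      + Ar * (n1 + n2)%:R))%:E <= _)%E).
    apply: lee_sum => q uq; rewrite EFinM lee_wpmul2l ?lee_fin ?invr_ge0//.
    have tq : testable qa q by rewrite /testable uq nst fq.
    by rewrite testable_lu// lee_fin start_le_search.
  by rewrite sumEFin lee_fin search_average.
rewrite -[leRHS](integral_probability_cst P).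
apply: ge0_le_integral => //.
- by move=> w _; exact: cost_potential_ge0.
- exact: (measurableT_comp measurable_cost_potential (measurable_aim_cst i _)).
move=> w _.
have [q [nq uq qx]] := next_query_cross (U i w) order_cross nst fq.
rewrite /aim /= /target nq.
have tq : testable qa q by rewrite /testable uq nst fq.
rewrite testable_lu// /cost_potential /= (negbTE nst) lee_fin.
have := test_cost_start qa q; rewrite /cost_left_after /cost_left fq.
move: (test_cost _ _ _) (unS qa) (unC qa x) => t a b.
by case: (q \in S) => /= ht; move: Ar0; lra.
Qed.

Lemma cost_bound N :
  (\sum_(i < N) \int[P]_w
     (precision s delta mu Gamma order S (U ^~ w) (W ^~ w) i)%:E <=
   (A1 * s%:R + As * (J + 1 - s%:R / n%:R) + Ar * (n1 + n2)%:R)%:E)%E.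
Proof.
have h := drift_bound UW Gamma_gt0 cost_potential_ge0 measurable_cost_potential
  (ltW Gamma_gt0) cost_drift_aim cost_drift_observe N.
have pot0 : cost_potential (State [::] None) =
    (A1 * s%:R + As * (J + 1 - s%:R / n%:R) + Ar * (n1 + n2)%:R)%:E.
  by rewrite /cost_potential /stopped /= /cost_left card_unS0 addrA.
rewrite pot0 in h; apply: le_trans h.
rewrite (eq_bigr (fun i : 'I_N => \int[P]_w (if isSome (target s delta order (U i w)
  (run s delta mu Gamma order S (U ^~ w) (W ^~ w) i)) then Gamma else 0)%:E)%E).
  rewrite leeDr// integral_ge0// => w _; exact: cost_potential_ge0.
by move=> j _; apply: eq_integral => w _; rewrite /precision; case: target.
Qed.

End CostBound.

(** * Thresholds and stopping *)

Section Thresholds.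
Variables (R : realType) (n1 n2 s : nat) (delta : R).
Hypotheses (n_gt0 : (0 < n1 * n2)%N) (s_gt0 : (0 < s)%N) (s_le : (s <= n1 * n2)%N).
Hypothesis delta_itv : 0 < delta < 1.
Local Notation al := (alpha n1 n2 delta).
Implicit Types qa : seq (cell n1 n2 * bool).

Lemma alpha_itv : 0 < al <= delta / 8.
Proof.
have /andP[d0 _] := delta_itv; have n1' : 1 <= (n1 * n2)%:R :> R by rewrite ler1n.
rewrite /alpha divr_gt0 ?mulr_gt0//=; last by apply: lt_le_trans n1'.
by rewrite ler_pM2l// lef_pV2 ?posrE//; [lra|nra].
Qed.

Lemma beta_itv qa : al <= beta s delta qa <= delta / 4.
Proof.
have /andP[d0 _] := delta_itv; have s1 : 1 <= s%:R :> R by rewrite ler1n.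
have sn : s%:R <= (n1 * n2)%:R :> R by rewrite ler_nat.
have s8 : 0 < 8 * s%:R :> R by lra.
have n8 : 0 < 8 * (n1 * n2)%:R :> R by lra.
have -> : beta s delta qa =
    if found qa is Some _ then delta / (8 * s%:R) else delta / 4 by [].
rewrite /alpha; case: found => [_|]; rewrite !ler_pM2l// !lef_pV2 ?posrE//; lra.
Qed.

Lemma beta_gt0 qa : 0 < beta s delta qa.
Proof.
by have /andP[a0 _] := alpha_itv; have /andP[+ _] := beta_itv qa; exact: lt_le_trans.
Qed.

Lemma expR_lower qa : expR (lower s delta qa) = beta s delta qa / (1 - al).
Proof.
have /andP[a0 a1] := alpha_itv; have b0 := beta_gt0 qa; have /andP[_ d1] := delta_itv.
by rewrite /lower lnK// posrE divr_gt0//; lra.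
Qed.

Lemma expRN_upper qa : expR (- upper s delta qa) = al / (1 - beta s delta qa).
Proof.
have /andP[a0 a1] := alpha_itv; have /andP[_ b1] := beta_itv qa.
have /andP[_ d1] := delta_itv.
have p : 0 < (1 - beta s delta qa) / al by rewrite divr_gt0//; lra.
by rewrite expRN /upper lnK ?posrE// invf_div.
Qed.

Lemma lower_lt0 qa : lower s delta qa < 0.
Proof.
have /andP[a0 a1] := alpha_itv; have b0 := beta_gt0 qa; have /andP[_ d1] := delta_itv.
have /andP[_ b1] := beta_itv qa.
by rewrite -ltr_expR expR0 expR_lower ltr_pdivrMr; lra.
Qed.

Lemma upper_gt0 qa : 0 < upper s delta qa.
Proof.
have /andP[a0 a1] := alpha_itv; have b0 := beta_gt0 qa; have /andP[_ d1] := delta_itv.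
have /andP[_ b1] := beta_itv qa.
by rewrite -oppr_lt0 -ltr_expR expR0 expRN_upper ltr_pdivrMr; lra.
Qed.

End Thresholds.

Section Stopping.
Variables (R : realType) (n1 n2 s : nat) (delta mu Gamma : R).
Variables (order : cell n1 n2 -> seq (cell n1 n2)) (S : {set cell n1 n2}).
Variables (U : nat -> selector n1 n2) (W : nat -> R).
Local Notation traj := (run s delta mu Gamma order S U W).

(** Tests start only before stopping, and the answers do not change during a test. *)
Lemma test_not_stopped i : test (traj i) -> ~~ stopped s delta (answers (traj i)).
Proof.
elim: i => // i; rewrite runS; case: (traj i) => qa [[q z]|] /= IH.
  by rewrite /aim /observe /update /=; case: ifP => //; case: ifP.
rewrite /aim /= /target /=; case E : (next_query _ _ _ _ _) => [q|]//=.
rewrite /observe /update /=; case: ifP => //; case: ifP => //= _ _ _.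
by move: E; rewrite /next_query; case: ifP.
Qed.

Lemma run_stopped i k : stopped s delta (answers (traj i)) ->
  (i <= k)%N -> traj k = traj i.
Proof.
move=> st /subnK <-; elim: (k - i)%N => // j IH; rewrite addSn runS IH.
have : ~~ test (traj i) by apply/negP => /test_not_stopped; rewrite st.
case: (traj i) st => qa [?|]//= st _.
by rewrite /aim /= /target /next_query st.
Qed.

(** The state is frozen once stopped, so every admissible index gives the same estimate and the
    choice made in [estimator] is immaterial. *)
Lemma estimator_stopped i : stopped s delta (answers (traj i)) ->
  estimator s delta mu Gamma order S U W = estimate s (answers (traj i)).
Proof.
move=> st; rewrite /estimator; case: xgetP => [A _ [k [stk ->]]|/(_ _)]; last first.
  by move=> /(_ (estimate s (answers (traj i)))) []; exists i.
have [ik|/ltnW ki] := leqP i k; first by rewrite (run_stopped st ik).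
by rewrite -(run_stopped stk ki).
Qed.

Lemma estimator_never_stopped :
  (forall i, ~~ stopped s delta (answers (traj i))) ->
  estimator s delta mu Gamma order S U W = finset.set0.
Proof.
move=> nst; rewrite /estimator; case: xgetP => [A _ [k [stk _]]|//].
by have := nst k; rewrite stk.
Qed.

End Stopping.

(** * Probability of error *)

Section ErrorBound.
Context d (T : measurableType d) (R : realType) (P : probability T R).
Variables (n1 n2 : nat) (U : nat -> T -> selector n1 n2) (W : nat -> {RV P >-> R}).
Hypothesis UW : sensing_model U W.
Variables (s : nat) (delta mu Gamma : R) (order : cell n1 n2 -> seq (cell n1 n2)).
Variable S : {set cell n1 n2}.
Hypotheses (n1_gt0 : (0 < n1)%N) (n2_gt0 : (0 < n2)%N) (s_gt0 : (0 < s)%N).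
Hypothesis order_cross : forall c, order c =i cross c.
Hypothesis SC : S \in submatrices n1 n2 s.
Hypothesis Gamma_gt0 : 0 < Gamma.
Hypothesis delta_itv : 0 < delta < 1.

Local Notation state := (state R n1 n2).
Local Notation n := (n1 * n2)%N.
Local Notation theta := (llr_sd mu Gamma).
Local Notation J := (max_search n1 n2 s delta).
Local Notation al := (alpha n1 n2 delta).
Implicit Types (qa : seq (cell n1 n2 * bool)) (q : cell n1 n2).

Let n_gt0 : (0 < n)%N. Proof. by rewrite muln_gt0 n1_gt0. Qed.
Let s_le : (s <= n)%N. Proof. exact: s_le_n SC. Qed.

(* Wald's bounds on the error probabilities of the tests: false alarm, miss in
   the search phase, miss in the refinement phase. *)
Let ea : R := al / (1 - delta / 4).
Let es : R := delta / 4 / (1 - al).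
Let er : R := delta / (8 * s%:R) / (1 - al).
(** Type II error of a search that hits the support: as long as the answers are correct, a single
    support coordinate is tested in the search, and at most [s] in the refinement. *)
Let eb : R := es + s%:R * er.

Let al_itv : 0 < al <= delta / 8. Proof. exact: alpha_itv. Qed.

Let ea_ge0 : 0 <= ea.
Proof.
have /andP[a0 a1] := al_itv; have /andP[d0 d1] := delta_itv.
by rewrite divr_ge0//; lra.
Qed.

Let er_ge0 : 0 <= er.
Proof.
have /andP[a0 a1] := al_itv; have /andP[d0 d1] := delta_itv.
by rewrite divr_ge0 ?divr_ge0 ?mulr_ge0//; lra.
Qed.

Let ebE : eb = 3 / 8 * delta / (1 - al).
Proof.
have /andP[a0 a1] := al_itv; have /andP[d0 d1] := delta_itv.
rewrite /eb /es /er; field; rewrite pnatr_eq0 -lt0n s_gt0 /=; lra.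
Qed.

Let eb_itv : 0 <= eb <= 1.
Proof.
have /andP[a0 a1] := al_itv; have /andP[d0 d1] := delta_itv.
by rewrite ebE divr_ge0 ?ler_pdivrMr//=; lra.
Qed.

(* Bound on the probability that [J] uniform queries, of which [t] have been
   made, all miss the support. *)
Let miss (t : nat) : R := expR (- (s%:R / n%:R * (J - t%:R))).

Let unS qa : R := #|S :&: unqueried qa|%SET%:R.
Let unN qa : R := #|~: S :&: unqueried qa|%SET%:R.

Definition correct qa : bool := all (fun a => a.2 == (a.1 \in S)) qa.

(** Each unqueried null coordinate may still cause a false alarm. During the search, the other two
    failures combine as p + (1 - p) eb, where p bounds the probability of missing the support. *)
Definition error_left qa : R :=
  ea * unN qa + if found qa is Some _ then er * unS qa
                else miss (size qa) * (1 - eb) + eb.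

Definition test_error qa q z : R :=
  expR (if q \in S then lower s delta qa - z else z - upper s delta qa).

(* Bounds the probability of an error; during a test it contains the likelihood
   ratio against the truth, which is a martingale. *)
Definition error_potential (st : state) : \bar R :=
  match test st with
  | None => (if correct (answers st) then error_left (answers st) else 1)%:E
  | Some (q, z) =>
    if q \in unqueried (answers st) then
      (if correct (answers st)
       then test_error (answers st) q z + error_left (rcons (answers st) (q, q \in S))
       else 1)%:E
    else +oo%E
  end.

Let unS_after qa q b : q \in unqueried qa ->
  unS (rcons qa (q, b)) = unS qa - (q \in S)%:R.
Proof. exact: card_setI_unqueried_rcons. Qed.

Let unN_after qa q b : q \in unqueried qa ->
  unN (rcons qa (q, b)) = unN qa - (q \notin S)%:R.
Proof.
by move=> uq; rewrite /unN (card_setI_unqueried_rcons R _ _ uq) finset.in_setC.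
Qed.

Let correct_rcons qa q b :
  correct (rcons qa (q, b)) = correct qa && (b == (q \in S)).
Proof. by rewrite /correct all_rcons andbC. Qed.

Let error_left_ge0 qa : 0 <= error_left qa.
Proof.
have /andP[b0 b1] := eb_itv.
apply: addr_ge0; first exact: mulr_ge0.
case: (found qa) => [_|]; first exact: mulr_ge0.
by rewrite addr_ge0// mulr_ge0 ?expR_ge0// subr_ge0.
Qed.

Let test_error_ge0 qa q z : 0 <= test_error qa q z.
Proof. exact: expR_ge0. Qed.

Lemma error_potential_ge0 st : (0 <= error_potential st)%E.
Proof.
case: st => qa [[q z]|]; rewrite /error_potential /=.
  by case: ifP => // _; rewrite lee_fin; case: ifP => // _; rewrite addr_ge0.
by rewrite lee_fin; case: ifP.
Qed.

Lemma measurable_error_potential : measurable_fun setT error_potential.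
Proof.
pose g (a : seq (cell n1 n2 * bool) * option (cell n1 n2)) (st : state) :=
  error_potential (state_of a (state_value st)).
refine (@measurable_fun_countable_cases _ _ _ state _ (@state_shape R n1 n2) _ g _ _ _).
- exact: measurable_state_shape.
- move=> [qa [q|]]; rewrite /g /error_potential /=; last exact: measurable_cst.
  case: (q \in unqueried qa); last exact: measurable_cst.
  case: (correct qa); last exact: measurable_cst.
  apply/measurable_EFinP/measurable_funD => //.
  apply: (measurableT_comp (@measurable_expR R)).
  have mz := @measurable_state_value R n1 n2.
  by case: (q \in S); exact: measurable_funB.
- by move=> st; rewrite /g state_ofK.
Qed.

(** Under the truth, the exponential in [test_error] has mean-one increments: the drift - theta^2 /
    2 in [a] cancels the normal factor e^(theta^2 / 2). At or beyond the wrong boundary it is at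
    least 1, so the overshoot only helps. The zero cost keeps the form required by [drift_bound]. *)
Lemma error_drift_observe (st : state) :
  (\int[normal_prob 0 1]_y error_potential (observe s delta mu Gamma S st y) +
   (if test st then 0 else 0)%:E <= error_potential st)%E.
Proof.
rewrite if_same adde0.
case: st => qa [[q z]|]; last by rewrite /observe /= integral_probability_cst.
rewrite [leRHS]/error_potential /=; case: ifPn => [uq|_]; last exact: leey.
have mvo := measurableT_comp measurable_error_potential
  (measurable_observe s delta mu S Gamma_gt0).
have mobs : measurable_fun setT (fun y => error_potential
    (observe s delta mu Gamma S (State qa (Some (q, z))) y)).
  exact: (measurableT_comp mvo (pair1_measurable (State qa (Some (q, z))))).
have [cqa|ncqa] := boolP (correct qa); last first.
  rewrite -[leRHS](integral_probability_cst (normal_prob 0 1)).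
  apply: ge0_le_integral => //.
    by move=> y _; exact: error_potential_ge0.
  move=> y _; apply: (@observe_le _ _ _ s delta mu Gamma S Gamma_gt0
    error_potential (fun=> 1%E) qa q z y) => y' _; rewrite /error_potential /=.
  - by rewrite correct_rcons (negbTE ncqa).
  - by rewrite correct_rcons (negbTE ncqa).
  - by rewrite uq (negbTE ncqa).
set C := error_left _; have C0 : 0 <= C by exact: error_left_ge0.
pose a := if q \in S then lower s delta qa - z - theta ^+ 2 / 2
          else z - upper s delta qa - theta ^+ 2 / 2.
pose t := if q \in S then - theta else theta.
have stepE y : test_error qa q (z + llr_step mu Gamma S q y) = 1 * expR (a + t * y).
  rewrite mul1r /test_error /llr_step /a /t.
  by case: ifP => qS; rewrite ?qS; congr expR; ring.
have le_obs y : (error_potential (observe s delta mu Gamma S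
    (State qa (Some (q, z))) y) <= (1 * expR (a + t * y))%:E + C%:E)%E.
  pose p y := (test_error qa q y + C)%:E.
  have := @observe_le _ _ _ s delta mu Gamma S Gamma_gt0 error_potential p qa q z y.
  rewrite /p stepE EFinD; apply=> y'.
  - rewrite -subr_ge0 => yu; rewrite /error_potential /= lee_fin correct_rcons cqa /=.
    case: (boolP (q \in S)) => qS; first by rewrite /C qS lerDr.
    rewrite ler_wpDr// /test_error (negbTE qS).
    by rewrite -[leLHS]expR0 ler_expR.
  - rewrite -subr_ge0 => yl; rewrite /error_potential /= lee_fin correct_rcons cqa /=.
    case: (boolP (q \in S)) => qS; last by rewrite /C (negbTE qS) lerDr.
    rewrite ler_wpDr// /test_error qS.
    by rewrite -[leLHS]expR0 ler_expR.
  - by move=> _; rewrite /error_potential /= uq cqa.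
have mexp : measurable_fun setT (fun y : R => (1 * expR (a + t * y))%:E).
  apply/measurable_EFinP/measurable_funM => //.
  apply: (measurableT_comp (@measurable_expR R)).
  by apply: measurable_funD => //; apply: measurable_funM.
have intle : (\int[normal_prob 0 1]_y error_potential (observe s delta mu Gamma S
      (State qa (Some (q, z))) y) <=
    \int[normal_prob 0 1]_y ((1 * expR (a + t * y))%:E + C%:E))%E.
  apply: ge0_le_integral => //.
  - by move=> y _; exact: error_potential_ge0.
  - exact: emeasurable_funD.
apply: le_trans intle _.
rewrite ge0_integralD//=.
rewrite integral_probability_cst integral_normal_expR_affine// -EFinD lee_fin lerD2r.
rewrite mul1r /test_error ler_expR /a /t; case: ifP => _; rewrite ?sqrrN; lra.
Qed.

(** Wald's bounds are the starting values of the martingale; the one for false alarms is made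
    uniform over the phases by beta <= delta / 4. *)
Let test_error_start qa q : test_error qa q 0 <=
  if q \in S then if found qa is Some _ then er else es else ea.
Proof.
have /andP[a0 a1] := al_itv; have /andP[d0 d1] := delta_itv.
rewrite /test_error; case: ifP => _.
  by rewrite subr0 expR_lower// /beta; case: (found qa).
rewrite sub0r expRN_upper//; have /andP[_ b1] := beta_itv s_gt0 s_le delta_itv qa.
by rewrite ler_pM2l// lef_pV2 ?posrE; lra.
Qed.

Let unS_le qa : unS qa <= s%:R.
Proof.
rewrite ler_nat -(card_submatrix SC); apply: subset_leq_card.
exact: finset.subsetIl.
Qed.

Let start_found qa q x : q \in unqueried qa -> found qa = Some x ->
  test_error qa q 0 + error_left (rcons qa (q, q \in S)) <= error_left qa.
Proof.
move=> uq fq; have := test_error_start qa q; rewrite fq.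
rewrite /error_left found_rcons fq (unS_after _ uq) (unN_after _ uq).
by case: (q \in S) => /=; move: (unS qa) (unN qa) (test_error qa q 0) => u v e; lra.
Qed.

Let start_search qa q : q \in unqueried qa -> found qa = None ->
  test_error qa q 0 + error_left (rcons qa (q, q \in S)) <=
  ea * unN qa + eb + (q \notin S)%:R * (miss (size qa).+1 * (1 - eb)).
Proof.
move=> uq fq; have := test_error_start qa q; rewrite fq.
rewrite /error_left found_rcons fq (unS_after _ uq) (unN_after _ uq) size_rcons.
have := ler_wpM2l er_ge0 (unS_le qa); rewrite [_ * s%:R]mulrC.
have := er_ge0; rewrite /eb.
by case: (q \in S) => /=; move: (unS qa) (unN qa) (test_error qa q 0) => u v e; lra.
Qed.

Let miss_step t : (1 - s%:R / n%:R) * miss t.+1 <= miss t.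
Proof.
have -> : miss t = expR (- (s%:R / n%:R)) * miss t.+1.
  by rewrite /miss -expRD -natr1; congr expR; ring.
by rewrite ler_wpM2r ?expR_ge0//; exact: expR_ge1Dx.
Qed.

(** While all answers are correct and negative, no support coordinate has been queried, so the next
    query hits the support with probability s / #|A| >= s / n: sampling without replacement only
    helps. *)
Let error_average qa : unqueried qa != finset.set0 -> correct qa ->
  found qa = None ->
  \sum_(q in unqueried qa) #|unqueried qa|%:R^-1 *
     (ea * unN qa + eb + (q \notin S)%:R * (miss (size qa).+1 * (1 - eb)))
  <= error_left qa.
Proof.
move=> u0 cqa fq; have /andP[b0 b1] := eb_itv.
set A := unqueried qa; set G := miss _ * _.
have G0 : 0 <= G by rewrite mulr_ge0 ?expR_ge0// subr_ge0.
have A0 : 0 < #|A|%:R :> R by rewrite ltr0n card_gt0.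
have SA : S \subset A.
  apply/fintype.subsetP => q qS; rewrite /A in_unqueried; apply/mapP => -[[q' b] aqa /= qq'].
  have /allP/(_ _ aqa) /= := cqa; rewrite -qq' qS => /eqP bT.
  by have := found_None fq aqa; rewrite /= bT.
rewrite (_ : \sum_(q in A) _ = \sum_(q in A) (#|A|%:R^-1 * (ea * unN qa + eb + G) -
    #|A|%:R^-1 * G * (q \in S)%:R)); last first.
  by apply: eq_bigr => q _; case: (q \in S) => /=; ring.
rewrite sumrB sumr_const -[_ *+ _]mulr_natr mulrAC mulVf ?gt_eqF// mul1r -mulr_sumr.
have -> : \sum_(q in A) (q \in S)%:R = s%:R :> R.
  rewrite -(card_submatrix SC) -sum1_card natr_sum [RHS]big_mkcond [LHS]big_mkcond/=.
  apply: eq_bigr => q _; have := fintype.subsetP SA q.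
  by case: (q \in S) => [->//|_]; rewrite if_same.
rewrite /error_left fq.
have An : #|A|%:R <= n%:R :> R.
  by rewrite ler_nat (leq_trans (max_card _))// card_prod !card_ord.
have h1 : s%:R / n%:R * G <= #|A|%:R^-1 * G * s%:R.
  rewrite -[leRHS]mulrA [leLHS](_ : _ = n%:R^-1 * (G * s%:R)); last by ring.
  apply: ler_wpM2r; first exact: mulr_ge0.
  by rewrite lef_pV2// posrE (lt_le_trans A0 An).
have := ler_wpM2r (_ : 0 <= 1 - eb) (miss_step (size qa)).
rewrite subr_ge0 => /(_ b1); rewrite -mulrA -/G; lra.
Qed.

Lemma error_drift_aim i st :
  (\int[P]_w error_potential (aim s delta order (U i w) st) <= error_potential st)%E.
Proof.
case: st => qa [[q z]|]; first by rewrite /aim /= integral_probability_cst.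
have [st|nst] := boolP (stopped s delta qa).
  by rewrite /aim /= /target /next_query st /= integral_probability_cst.
case fq : (found qa) => [x|]; last first.
  have u0 : unqueried qa != finset.set0.
    by apply: contra nst => /eqP; exact: stopped_all_queried.
  have aimE w : error_potential (aim s delta order (U i w) (State qa None)) =
      error_potential (State qa (Some (U i w (unqueried qa), 0))).
    by rewrite /aim /= /target /next_query (negbTE nst) fq.
  under eq_integral do rewrite aimE.
  rewrite (integral_selector i UW u0 (fun q => error_potential_ge0 (State qa (Some (q, 0))))).
  rewrite [leRHS]/error_potential /=.
  have [cqa|ncqa] := boolP (correct qa).
    apply: le_trans (_ : (\sum_(q in unqueried qa) (#|unqueried qa|%:R^-1 *
       (ea * unN qa + eb + (q \notin S)%:R * (miss (size qa).+1 * (1 - eb))))%:E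
       <= _)%E).
      apply: lee_sum => q uq; rewrite EFinM lee_wpmul2l ?lee_fin ?invr_ge0//.
      by rewrite /error_potential /= uq cqa lee_fin start_search.
    by rewrite sumEFin lee_fin error_average.
  rewrite (eq_bigr (fun=> (#|unqueried qa|%:R^-1)%:E)).
    rewrite sumEFin sumr_const -[_ *+ _]mulr_natr mulVf//.
    by rewrite pnatr_eq0 cards_eq0.
  by move=> q uq; rewrite /error_potential /= uq (negbTE ncqa) mule1.
rewrite -[leRHS](integral_probability_cst P).
apply: ge0_le_integral => //.
- by move=> w _; exact: error_potential_ge0.
- apply: (measurableT_comp measurable_error_potential).
  apply: (@measurable_aim _ _ _ s delta order _ T U i (fun=> State qa None)) => //.
  by move=> f; case: UW => mU _ _ _; exact: mU.
move=> w _.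
have [q [nq uq qx]] := next_query_cross (U i w) order_cross nst fq.
rewrite /aim /= /target nq /error_potential /= uq lee_fin.
by case: ifP => // _; exact: start_found fq.
Qed.

(** The first-order terms 1/8, 3/8 and 1/2 of delta leave nothing to spare. The cross term - 3
    delta^2 / 16 from the factor 1 - delta / 2 outweighs the excess delta^2 / 24 + 3 delta^2 / 56
    due to the denominators. *)
Let error_left0 : error_left [::] <= delta.
Proof.
have /andP[d0 d1] := delta_itv; have /andP[a0 a1] := al_itv.
have n0 : 0 < n%:R :> R by rewrite ltr0n.
have s0 : 0 < s%:R :> R by rewrite ltr0n.
have missE : miss 0 = delta / 2.
  rewrite /miss subr0 /max_search mulrA.
  rewrite [s%:R / _ * _](_ : _ = 1); last first.
    by rewrite mulf_div [n%:R * _]mulrC divff// mulf_neq0// gt_eqF.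
  by rewrite mul1r expRN lnK ?invf_div// posrE divr_gt0.
(* On (0, 1), 1 / (1 - delta / 4) <= 1 + delta / 3; below, likewise, 1 / (1 - delta / 8) <= 1 +
   delta / 7. *)
have h1 : ea * unN [::] <= delta / 8 * (1 + delta / 3).
  have uN : unN [::] <= n%:R.
    by rewrite ler_nat (leq_trans (max_card _))// card_prod !card_ord.
  apply: le_trans (ler_wpM2l ea_ge0 uN) _.
  rewrite (_ : ea * n%:R = delta / 8 / (1 - delta / 4)); last first.
    rewrite /ea mulrAC; congr (_ / _); rewrite /alpha.
    by move: (n%:R) n0 => N N0; field; rewrite gt_eqF.
  by rewrite ler_pdivrMr; [nra|lra].
have h2 : eb <= 3 / 8 * delta * (1 + delta / 7).
  rewrite ebE ler_pdivrMr; last lra.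
  apply: le_trans (_ : 3 / 8 * delta * (1 + delta / 7) * (1 - delta / 8) <= _).
    by nra.
  by rewrite ler_wpM2l//; nra.
rewrite /error_left /= missE.
have h3 : delta / 2 * (1 - eb) + eb <=
    delta / 2 + (1 - delta / 2) * (3 / 8 * delta * (1 + delta / 7)).
  have := ler_wpM2l (_ : 0 <= 1 - delta / 2) h2; rewrite subr_ge0 => /(_ _); lra.
apply: le_trans (lerD h1 h3) _; nra.
Qed.

(** If all answers are correct, the support is itself consistent, so a stop with at most one
    candidate returns it. The only other stop is an exhausted search, for which at least [J] queries
    make [miss] at least 1. *)
Lemma stopped_error qa : stopped s delta qa -> estimate s qa != S ->
  (1 <= error_potential (State qa None))%E.
Proof.
rewrite /error_potential /= => st eS; rewrite lee_fin.
case: ifPn => // cqa; have SCqa : S \in consistent s qa.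
  by rewrite in_consistent SC.
move: st; rewrite /stopped => /andP[_ /orP[c1|/andP[/eqP fq Jq]]].
  have cE : consistent s qa = [set S]%SET.
    by apply/eqP; rewrite eq_sym eqEcard finset.sub1set SCqa cards1.
  move: eS; rewrite /estimate; case: pickP => [A|/(_ S)]; last by rewrite cE eqxx.
  by rewrite cE => /eqP/finset.set1_inj ->; rewrite eqxx.
rewrite /error_left fq; apply: ler_wpDl; first exact: mulr_ge0.
have /andP[b0 b1] := eb_itv.
have m1 : 1 <= miss (size qa).
  rewrite -[leLHS]expR0 ler_expR oppr_ge0 mulr_ge0_le0 ?divr_ge0//.
  by rewrite subr_le0.
have b1' : 0 <= 1 - eb by rewrite subr_ge0.
by have := ler_wpM2r b1' m1; lra.
Qed.

Lemma error_bound N :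
  (\int[P]_w error_potential (run s delta mu Gamma order S (U ^~ w) (W ^~ w) N)
   <= delta%:E)%E.
Proof.
have h := drift_bound UW Gamma_gt0 error_potential_ge0 measurable_error_potential
  (lexx 0) error_drift_aim error_drift_observe N.
apply: le_trans (_ : error_potential (State [::] None) <= _)%E; last first.
  by rewrite /error_potential /= lee_fin.
apply: le_trans h; rewrite leeDl// sume_ge0// => i _.
by apply: integral_ge0 => w _; rewrite lee_fin; case: ifP.
Qed.

End ErrorBound.

(** * Total precision and almost sure stopping *)

Section Budget.
Context d (T : measurableType d) (R : realType) (P : probability T R).
Variables (n1 n2 : nat) (U : nat -> T -> selector n1 n2) (W : nat -> {RV P >-> R}).
Hypothesis UW : sensing_model U W.
Variables (s : nat) (delta mu Gamma : R) (order : cell n1 n2 -> seq (cell n1 n2)).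
Variable S : {set cell n1 n2}.
Hypothesis order_cross : forall c, order c =i cross c.
Hypothesis Gamma_gt0 : 0 < Gamma.
Variable m : R.
Local Notation traj i w := (run s delta mu Gamma order S (U ^~ w) (W ^~ w) i).
Local Notation prec i w := (precision s delta mu Gamma order S (U ^~ w) (W ^~ w) i).
Hypothesis budget : forall N, (\sum_(i < N) \int[P]_w (prec i w)%:E <= m%:E)%E.

Let prec_ge0 i w : (0 <= (prec i w)%:E)%E.
Proof. by rewrite lee_fin /precision; case: target => // _; exact: ltW. Qed.

Let measurable_prec i : measurable_fun setT (fun w => (prec i w)%:E).
Proof.
rewrite (_ : (fun w => (prec i w)%:E) =
    (fun st => (if test st then Gamma else 0)%:E) \o
    (fun w => aim s delta order (U i w) (traj i w))).
  apply: (measurableT_comp (@measurable_testing R n1 n2 Gamma)).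
  exact: measurable_aimed.
apply/funext => w; rewrite /precision /= target_aim.
by case: (test _) => [[]|].
Qed.

Lemma total_precision_le :
  (\int[P]_w total_precision s delta mu Gamma order S (U ^~ w) (W ^~ w) <= m%:E)%E.
Proof.
rewrite /total_precision integral_nneseries//.
apply: lime_le.
  by apply: is_cvg_nneseries => i _ _; exact: integral_ge0.
by apply: nearW => N; rewrite big_mkord; exact: budget.
Qed.

Let never : set T := [set w | forall i, ~~ stopped s delta (answers (traj i w))].

Lemma measurable_traj_answers i (p : pred (seq (cell n1 n2 * bool))) :
  measurable [set w | p (answers (traj i w))].
Proof.
have := measurable_traj UW s delta mu order Gamma_gt0 S i measurableT
  (measurable_answers p).
by rewrite setTI.
Qed.

Lemma measurable_never_stopped : measurable never.
Proof.
rewrite (_ : never =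
    \bigcap_i [set w | ~~ stopped s delta (answers (traj i w))]).
  apply: bigcapT_measurable => i.
  exact: (measurable_traj_answers i (fun qa => ~~ stopped s delta qa)).
by rewrite eqEsubset; split=> w /= h i; [move=> _|]; exact: h.
Qed.

(** On this event every measurement is made, so N Gamma P(never) <= m for all N. *)
Lemma never_stopped_null : P never = 0%E.
Proof.
have prec_never i : ((Gamma%:E * P never) <= \int[P]_w (prec i w)%:E)%E.
  have -> : P never = (\int[P]_w (\1_never w)%:E)%E.
    by rewrite integral_indic ?setIT//; exact: measurable_never_stopped.
  rewrite -ge0_integralZl//; last 2 first.
  - exact/measurable_EFinP/measurable_indic/measurable_never_stopped.
  - exact: ltW.
  apply: ge0_le_integral => //.
  - by move=> w _; rewrite mule_ge0// lee_fin ltW.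
  - apply: emeasurable_funM => //.
    exact/measurable_EFinP/measurable_indic/measurable_never_stopped.
  move=> w _; rewrite indicE; case: (boolP (w \in never)) => wn; last by rewrite mule0.
  have := target_not_stopped (U i w) order_cross (set_mem wn i).
  by rewrite mule1 /precision; case: target.
have : P never \is a fin_num by rewrite fin_num_measure//; exact: measurable_never_stopped.
case E : (P never) => [p| |]// _; rewrite E in prec_never.
have p0 : 0 <= p by rewrite -lee_fin -E.
have pN N : N%:R * (Gamma * p) <= m.
  rewrite -lee_fin; apply: le_trans (budget N).
  apply: le_trans (_ : (\sum_(i < N) (Gamma * p)%:E <= _)%E).
    by rewrite sumEFin sumr_const card_ord lee_fin mulr_natl.
  by apply: lee_sum => i _; exact: prec_never.
apply/eqP; rewrite eqe eq_le p0 andbT leNgt; apply/negP => p_gt0.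
have Gp : 0 < Gamma * p by rewrite mulr_gt0.
have := pN (Num.truncn (m / (Gamma * p))).+1.
rewrite leNgt -ltr_pdivrMr// => /negP; apply.
exact: truncnS_gt.
Qed.

End Budget.

(** * From the error potential to the probability of error *)

Section ErrorProbability.
Context d (T : measurableType d) (R : realType) (P : probability T R).
Variables (n1 n2 : nat) (U : nat -> T -> selector n1 n2) (W : nat -> {RV P >-> R}).
Hypothesis UW : sensing_model U W.
Variables (s : nat) (delta mu Gamma : R) (order : cell n1 n2 -> seq (cell n1 n2)).
Variable S : {set cell n1 n2}.
Hypotheses (n1_gt0 : (0 < n1)%N) (n2_gt0 : (0 < n2)%N) (s_gt0 : (0 < s)%N).
Hypothesis order_cross : forall c, order c =i cross c.
Hypothesis SC : S \in submatrices n1 n2 s.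
Hypothesis Gamma_gt0 : 0 < Gamma.
Hypothesis delta_itv : 0 < delta < 1.
Local Notation traj i w := (run s delta mu Gamma order S (U ^~ w) (W ^~ w) i).
Let never : set T := [set w | forall i, ~~ stopped s delta (answers (traj i w))].
Hypothesis never0 : P never = 0%E.

(** The potential dominates the indicator of having stopped wrongly by time [i]. These events
    increase to the error event, up to the null event of never stopping, and continuity from below
    passes to the limit. On that null event the estimator is empty, hence wrong because s > 0. *)
Lemma error_probability_le :
  (P [set w | estimator s delta mu Gamma order S (U ^~ w) (W ^~ w) != S]
   <= delta%:E)%E.
Proof.
pose wrong (qa : seq (cell n1 n2 * bool)) := stopped s delta qa && (estimate s qa != S).
pose E i := [set w | wrong (answers (traj i w))].
have mE i : measurable (E i) by exact: measurable_traj_answers.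
have mnever : measurable never by exact: measurable_never_stopped.
have -> : [set w | estimator s delta mu Gamma order S (U ^~ w) (W ^~ w) != S] =
    never `|` \bigcup_i E i.
  rewrite eqEsubset; split=> w /=.
    move=> eS; have [|nst] := pselect (forall i, ~~ stopped s delta (answers (traj i w))).
      by left.
    right; move/existsNP: nst => [i /negP]; rewrite negbK => st.
    by exists i => //; rewrite /E /wrong /= st /= -(estimator_stopped st).
  move=> [nst|[i _ /andP[st eS]]]; last by rewrite (estimator_stopped st).
  rewrite estimator_never_stopped//; apply: contraTneq s_gt0 => S0.
  by rewrite -(card_submatrix SC) -S0 cards0.
have PE i : (P (E i) <= delta%:E)%E.
  apply: le_trans (error_bound UW mu n1_gt0 n2_gt0 s_gt0 order_cross SC Gamma_gt0
    delta_itv i).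
  have -> : P (E i) = (\int[P]_w (\1_(E i) w)%:E)%E.
    by rewrite integral_indic ?setIT.
  apply: ge0_le_integral => //.
  - exact/measurable_EFinP/measurable_indic.
  - exact: (measurableT_comp (measurable_error_potential _ _ _)
      (measurable_traj UW s delta mu order Gamma_gt0 S i)).
  move=> w _; rewrite indicE; case: (boolP (w \in E i)) => [/set_mem wE|_]; last first.
    by apply: error_potential_ge0.
  have /andP[st eS] := wE.
  have tN : test (traj i w) = None.
    by case tE : (test _) => //; have := @test_not_stopped _ _ _ s delta mu Gamma order
      S (U ^~ w) (W ^~ w) i; rewrite tE st => /(_ isT).
  have -> : traj i w = State (answers (traj i w)) None.
    by case: (traj i w) tN => qa t /= ->.
  by apply: stopped_error.
have mUE : measurable (\bigcup_i E i) by exact: bigcupT_measurable.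
have U2 : (P (never `|` \bigcup_i E i) <= P never + P (\bigcup_i E i))%E.
  exact: measureU2.
rewrite never0 add0e in U2; apply: le_trans U2 _.
have ndE : nondecreasing_seq E.
  move=> i j ij; apply/subsetPset => w /andP[st eS].
  by rewrite /E /= (run_stopped st ij) /wrong st eS.
have cE := @nondecreasing_cvg_mu _ _ _ P E mE mUE ndE.
rewrite -(cvg_lim _ cE)//; apply: lime_le; first by apply/cvg_ex; eexists; exact: cE.
by apply: nearW.
Qed.

End ErrorProbability.

(** * Constants *)

Section Constants.
Variables (R : realType) (n1 n2 s : nat) (m delta mu : R).
Hypotheses (n1_gt0 : (0 < n1)%N) (n2_gt0 : (0 < n2)%N) (s_gt0 : (0 < s)%N).
Hypotheses (s_le : (s <= n1 * n2)%N) (m_gt0 : 0 < m) (delta_itv : 0 < delta < 1).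
Hypothesis mu_gt0 : 0 < mu.
Local Notation n := (n1 * n2)%N.
Local Notation al := (alpha n1 n2 delta).

Let n_gt0 : (0 < n)%N. Proof. by rewrite muln_gt0 n1_gt0. Qed.

Let L4 : R := ln (4 / delta).
Let L8n : R := ln (8 * n%:R / delta).
Let L8s : R := ln (8 * s%:R / delta).

Lemma ln_inv_beta_le (x : R) : 4 <= x -> x <= 8 * n%:R -> 0 <= ln (x / delta) <= L8n.
Proof.
move=> x4 xn; have /andP[d0 d1] := delta_itv; have x0 : 0 < x by lra.
rewrite ln_ge0 ?ler_pdivlMr ?ler_ln ?posrE ?divr_gt0 ?ler_pM2r ?invr_gt0//; lra.
Qed.

(** Uses alpha <= beta in both phases. The negative term ln (1 - alpha), shared with [lower_ge], is
    the room for the overshoot. *)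
Lemma upper_le (qa : seq (cell n1 n2 * bool)) :
  upper s delta qa <= L8n + ln (1 - al).
Proof.
have /andP[a0 a1] := @alpha_itv R n1 n2 delta n_gt0 delta_itv.
have /andP[b0 b1] := beta_itv s_gt0 s_le delta_itv qa.
have /andP[d0 d1] := delta_itv.
have n0 : 0 < n%:R :> R by rewrite ltr0n.
rewrite /upper lnM ?posrE ?invr_gt0//; last lra.
have -> : al^-1 = 8 * n%:R / delta by rewrite /alpha invf_div.
by rewrite addrC lerD2l ler_ln ?posrE; lra.
Qed.

Lemma lower_ge (qa : seq (cell n1 n2 * bool)) :
  - lower s delta qa = (if found qa is Some _ then L8s else L4) + ln (1 - al).
Proof.
have /andP[a0 a1] := @alpha_itv R n1 n2 delta n_gt0 delta_itv.
have b0 := beta_gt0 n_gt0 s_gt0 s_le delta_itv qa.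
have /andP[d0 d1] := delta_itv.
rewrite /lower -lnV ?posrE ?divr_gt0//; last lra.
rewrite invf_div lnM ?posrE ?invr_gt0//; last lra.
rewrite addrC; congr (_ + _); rewrite /beta.
by case: (found qa) => [_|]; rewrite invf_div.
Qed.

Lemma budget_constant_le :
  mu >= Num.sqrt
       (2 * n%:R / (s%:R * m) * L4 ^+ 2
        + 2 * s%:R / m * L8n
        + 2 * (n1 + n2)%:R / m * L8s) ->
  2 / mu ^+ 2 * L8n * s%:R +
  2 / mu ^+ 2 * L4 * (max_search n1 n2 s delta + 1 - s%:R / n%:R) +
  2 / mu ^+ 2 * L8s * (n1 + n2)%:R <= m.
Proof.
move=> hmu; have /andP[d0 d1] := delta_itv.
have s1 : 1 <= s%:R :> R by rewrite ler1n.
have sn : s%:R <= n%:R :> R by rewrite ler_nat.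
have n1' : 1 <= n%:R :> R by rewrite ler1n.
have /andP[L40 _] : 0 <= L4 <= L8n by apply: ln_inv_beta_le; lra.
have /andP[L8s0 _] : 0 <= L8s <= L8n by apply: ln_inv_beta_le; lra.
have /andP[L8n0 _] : 0 <= L8n <= L8n by apply: ln_inv_beta_le; lra.
have mu2 : 0 < mu ^+ 2 by rewrite exprn_gt0.
set X := (X in Num.sqrt X) in hmu.
have X0 : 0 <= X.
  have m0 := ltW m_gt0.
  by rewrite /X; do ?[done | exact: sqr_ge0 | apply: addr_ge0 | apply: mulr_ge0
    | rewrite invr_ge0].
have Xmu : X <= mu ^+ 2.
  by rewrite -[X in X <= _](sqr_sqrtr X0) ler_pXn2r ?nnegrE ?sqrtr_ge0// ltW.
(* Enough to absorb the rounding of the search length: with y = s / n, the claim 1 - y <= ln 2 / y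
   follows from y (1 - y) <= 1 / 4. *)
have ln2 : 1 / 2 <= ln 2 :> R.
  have h : ln (2^-1) <= - 2^-1 :> R.
    rewrite [X in ln X](_ : _ = 1 + - 2^-1 :> R); last lra.
    by apply: le_ln1Dx; lra.
  by move: h; rewrite lnV ?posrE//; lra.
have JE : max_search n1 n2 s delta = n%:R / s%:R * (L4 - ln 2).
  rewrite /max_search /L4; congr (_ * _).
  rewrite -ln_div ?posrE ?divr_gt0//; congr ln; field; lra.
have hL : max_search n1 n2 s delta + 1 - s%:R / n%:R <= n%:R / s%:R * L4.
  rewrite JE mulrBr.
  set y := s%:R / n%:R; have -> : n%:R / s%:R = y^-1 by rewrite /y invf_div.
  have y0 : 0 < y by rewrite divr_gt0//; lra.
  have : 1 - y <= y^-1 * ln 2.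
    by rewrite mulrC ler_pdivlMr//; nra.
  lra.
have hS := ler_wpM2l L40 hL.
rewrite (_ : _ + _ = (2 * (L8n * s%:R +
    L4 * (max_search n1 n2 s delta + 1 - s%:R / n%:R) + L8s * (n1 + n2)%:R))
    / mu ^+ 2); last by ring.
rewrite ler_pdivrMr//.
have -> : 2 * (L8n * s%:R +
    L4 * (max_search n1 n2 s delta + 1 - s%:R / n%:R) + L8s * (n1 + n2)%:R) =
  2 * (L4 * (max_search n1 n2 s delta + 1 - s%:R / n%:R)) +
  (2 * (L8n * s%:R) + 2 * (L8s * (n1 + n2)%:R)) by ring.
apply: le_trans (_ : m * X <= _); last by rewrite ler_pM2l.
have -> : m * X = 2 * (L4 * (n%:R / s%:R * L4)) +
    (2 * (L8n * s%:R) + 2 * (L8s * (n1 + n2)%:R)).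
  rewrite /X; move: (n%:R) (s%:R) s1 ((n1 + n2)%:R) => N r r1 M.
  by field; rewrite !gt_eqF//; lra.
by rewrite lerD2r ler_pM2l.
Qed.

Lemma test_constants : exists c eps theta0 : R,
  [/\ 0 <= c, 0 < eps, 0 < theta0,
    forall qa : seq (cell n1 n2 * bool),
      c * (upper s delta qa + eps) <= 2 / mu ^+ 2 * L8n /\
      c * (eps - lower s delta qa) <=
        if found qa is Some _ then 2 / mu ^+ 2 * L8s else 2 / mu ^+ 2 * L4 &
    forall theta, 0 < theta < theta0 ->
      [/\ theta <= 1, theta ^+ 2 / 2 <= eps &
        theta ^+ 2 / mu ^+ 2 <= c * (theta ^+ 2 / 2 -
          (1 + 4 * expR 1 / eps ^+ 2) * theta ^+ 3)]].
Proof.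
have /andP[a0 a1] := @alpha_itv R n1 n2 delta n_gt0 delta_itv.
have /andP[d0 d1] := delta_itv.
have n0 : 0 < n%:R :> R by rewrite ltr0n.
have s1 : 1 <= s%:R :> R by rewrite ler1n.
have sn : s%:R <= n%:R :> R by rewrite ler_nat.
have /andP[L40 L4L] : 0 <= L4 <= L8n by apply: ln_inv_beta_le; lra.
have /andP[L8s0 L8sL] : 0 <= L8s <= L8n by apply: ln_inv_beta_le; lra.
have mu2 : 0 < mu ^+ 2 by rewrite exprn_gt0.
have lnal : ln al = - L8n.
  by rewrite -lnV ?posrE ?divr_gt0 ?mulr_gt0// invf_div.
have L8n0 : 0 < L8n by rewrite -oppr_lt0 -lnal ln_lt0// a0 /=; lra.
(* Half of the room: each boundary distance enlarged by [eps] is still [eps] short of the logarithm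
   that bounds it. *)
pose eps := - ln (1 - al) / 2.
have epsE : ln (1 - al) = - (2 * eps) by rewrite /eps; field.
have eps0 : 0 < eps.
  by rewrite divr_gt0// oppr_gt0 ln_lt0//; apply/andP; split; lra.
have epsL : eps < L8n.
  have : ln al <= ln (1 - al) by rewrite ler_ln ?posrE; lra.
  by rewrite lnal epsE; lra.
(* The largest factor by which the ideal rate 2 / mu^2 can be inflated while r (x - eps) <= x holds
   for every x up to [L8n]. *)
pose r := L8n / (L8n - eps).
have r0 : 0 < r by rewrite divr_gt0// subr_gt0.
have c0 : 0 <= 2 / mu ^+ 2 * r.
  by apply: mulr_ge0; [apply: divr_ge0; rewrite // ltW|rewrite ltW].
have cut x : 0 <= x <= L8n -> 2 / mu ^+ 2 * r * (x - eps) <= 2 / mu ^+ 2 * x.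
  move=> /andP[x0 xL]; rewrite -mulrA ler_pM2l ?divr_gt0//.
  rewrite /r mulrAC ler_pdivrMr ?subr_gt0//; nra.
pose K := 1 + 4 * expR 1 / eps ^+ 2.
have K0 : 0 < K by rewrite ltr_pwDl// mulr_ge0 ?invr_ge0 ?sqr_ge0// mulr_ge0 ?expR_ge0.
(* The third bound on theta gives 2 K theta <= eps / L8n = 1 - 1 / r, so the inflation [r] pays for
   the theta^3 term. The first two give theta <= 1 and theta^2 / 2 <= eps. *)
exists (2 / mu ^+ 2 * r), eps,
  (Num.min 1 (Num.min eps (eps / (2 * K * L8n)))); split=> //.
- by rewrite !lt_min ltr01 eps0 divr_gt0// !mulr_gt0.
- move=> qa; split.
    apply: le_trans (cut L8n _); last by rewrite ltW//=.
    apply: ler_wpM2l => //.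
    have := upper_le qa; rewrite epsE; lra.
  rewrite addrC lower_ge epsE.
  case: (found qa) => [_|].
    by apply: le_trans (cut L8s _); [|rewrite L8s0]; rewrite // ler_wpM2l; lra.
  by apply: le_trans (cut L4 _); [|rewrite L40]; rewrite // ler_wpM2l; lra.
move=> th /andP[th0]; rewrite !lt_min => /and3P[th1 theps thK].
have th1' := ltW th1; split=> //.
  by nra.
have Kth : 2 * K * th <= 1 - r^-1.
  have -> : 1 - r^-1 = eps / L8n.
    by rewrite /r invf_div; field; rewrite gt_eqF.
  move: thK; rewrite ltr_pdivlMr ?mulr_gt0// ler_pdivlMr// => /ltW.
  by apply: le_trans; rewrite le_eqVlt; apply/orP; left; apply/eqP; ring.
have factor (k q : R) : 2 / mu ^+ 2 * q * (th ^+ 2 / 2 - k * th ^+ 3) =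
    th ^+ 2 / mu ^+ 2 * (q * (1 - 2 * k * th)).
  by field; rewrite gt_eqF.
rewrite factor -/K.
rewrite ler_pMr ?divr_gt0 ?exprn_gt0//.
rewrite -[leLHS](divff (lt0r_neq0 r0)) ler_pM2l//; lra.
Qed.

End Constants.

Theorem proposition8 (R : realType) (n1 n2 s : nat) (m delta mu : R)
    (hn1 : (1 <= n1)%N) (hn2 : (1 <= n2)%N) (hs : (1 <= s)%N)
    (hm : 0 < m) (hdelta : 0 < delta < 1)
    (hC : submatrices n1 n2 s != finset.set0)
    (hmu0 : 0 < mu)
    (hmu : mu >= Num.sqrt
       (2 * (n1 * n2)%:R / (s%:R * m) * (ln (4 / delta)) ^+ 2
        + 2 * s%:R / m * ln (8 * (n1 * n2)%:R / delta)
        + 2 * (n1 + n2)%:R / m * ln (8 * s%:R / delta))) :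
  exists2 Gamma0 : R, 0 < Gamma0 &
  forall Gamma : R, 0 < Gamma < Gamma0 ->
  forall order : cell n1 n2 -> seq (cell n1 n2),
    (forall c, order c =i cross c) ->
  forall (d : measure_display) (Omega : measurableType d)
    (P : probability Omega R)
    (U : nat -> Omega -> selector n1 n2) (W : nat -> {RV P >-> R}),
    sensing_model U W ->
    (\big[maxe/-oo%E]_(S in submatrices n1 n2 s)
       P [set w | estimator s delta mu Gamma order S (U ^~ w) (W ^~ w) != S]%classic
     <= delta%:E)%E
    /\
    (forall S : {set cell n1 n2}, S \in submatrices n1 n2 s ->
       \int[P]_w total_precision s delta mu Gamma order S (U ^~ w) (W ^~ w)
       <= m%:E)%E.
Proof.
have n_gt0 : (0 < n1 * n2)%N by rewrite muln_gt0 hn1.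
have s_le : (s <= n1 * n2)%N by have /finset.set0Pn[S SC] := hC; exact: s_le_n SC.
have [c [eps [theta0 [c0 eps0 th0 cost drift]]]] :=
  test_constants hn1 hn2 hs s_le hdelta hmu0.
have mu2 : 0 < mu ^+ 2 by rewrite exprn_gt0.
(* Equivalent to sqrt(Gamma) mu < theta0. *)
exists ((theta0 / mu) ^+ 2); first by rewrite exprn_gt0// divr_gt0.
move=> Gamma /andP[G0 GG] order ord d Omega P U W UW.
have th_itv : 0 < llr_sd mu Gamma < theta0.
  rewrite /llr_sd mulr_gt0 ?sqrtr_gt0//= -ltr_pdivlMr//.
  by rewrite -(@ltr_pXn2r _ 2) ?nnegrE ?sqrtr_ge0 ?divr_ge0 ?sqr_sqrtr ?ltW.
have [th1 theps thc] := drift _ th_itv.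
have thE : llr_sd mu Gamma ^+ 2 / mu ^+ 2 = Gamma.
  by rewrite /llr_sd exprMn sqr_sqrtr ?ltW// mulfK ?gt_eqF.
have s1 : 1 <= s%:R :> R by rewrite ler1n.
have sn : s%:R <= (n1 * n2)%:R :> R by rewrite ler_nat.
have ln_ge (x : R) : 4 <= x -> x <= 8 * (n1 * n2)%:R ->
    0 <= 2 / mu ^+ 2 * ln (x / delta).
  move=> x4 xn; have /andP[l0 _] := ln_inv_beta_le hdelta x4 xn.
  by rewrite mulr_ge0// divr_ge0// ltW.
have budget S : S \in submatrices n1 n2 s -> forall N, (\sum_(i < N) \int[P]_w
    (precision s delta mu Gamma order S (U ^~ w) (W ^~ w) i)%:E <= m%:E)%E.
  move=> SC N.
  have := @cost_bound _ _ _ P _ _ U W UW s delta mu Gamma order S hn1 hn2 hs ord SC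
    G0 hdelta eps c (2 / mu ^+ 2 * ln (4 / delta)) (2 / mu ^+ 2 * ln (8 * s%:R / delta))
    (2 / mu ^+ 2 * ln (8 * (n1 * n2)%:R / delta)).
  move=> /(_ _ _ _ c0 eps0 _ theps) h; apply: le_trans (h _ _ _ _ _ _ _ _ _ N) _.
  - by apply: ln_ge; lra.
  - by apply: ln_ge; lra.
  - by apply: ln_ge; lra.
  - by case/andP: th_itv => -> _.
  - by rewrite -[leLHS]thE.
  - exact: lower_lt0.
  - exact: upper_gt0.
  - by move=> qa; case: (cost qa).
  - by move=> qa; case: (cost qa).
  - by rewrite lee_fin; exact: budget_constant_le.
split=> [|S SC]; last exact: total_precision_le (budget S SC).
apply/bigmax_leP; split=> [|S SC]; first exact: leNye.
(* The error bound relies on the budget, which rules out runs that never stop. *)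
have never0 := never_stopped_null UW ord G0 (budget S SC).
exact: error_probability_le.
Qed.
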